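(* Consider the iterates generated by the inexact adaptive proximal gradient method described in the context. The following hold: (i) $(\Phi_k)_{k\in\mathbb{N}}$ converges to a finite value $\varphi_\star\ge\inf\varphi$ from above. (ii) $\sum_{k\in\mathbb{N}}\frac1{\gamma_k}\|\bar x^k-x^k\|^2<\infty$. (iii) $\lim_{k\to\infty}\|x^k-\bar x^k\|=\lim_{k\to\infty}\|x^k-x^{k-1}\|=\lim_{k\to\infty}\|\bar x^k-\bar x^{k-1}\|=0$, and in particular the set of limit points of $(x^k)_{k\in\mathbb{N}}$ is closed and connected, and coincides with that of $(\bar x^k)_{k\in\mathbb{N}}$. (iv) $\sum_{k\in\mathbb{N}}\gamma_k=\infty$. (v) $\liminf_{k\to\infty}\frac1{\gamma_k}\|x^k-\bar x^k\|=0$. (vi) Consider the assertions: (1) $\varphi$ is level bounded (all sublevel sets $\{x:\varphi(x)\le c\}$, $c\in\mathbb{R}$, are bounded); (2) $(\bar x^k)_{k\in\mathbb{N}}$ is bounded; (3) $(x^k)_{k\in\mathbb{N}}$ is bounded; (4) $(\gamma_k)_{k\in\mathbb{N}}$ is asymptotically constant, i.e. there exists $\kappa\in\mathbb{N}$ such that $\gamma_k=\gamma_\kappa$ for every $k\ge\kappa$; (5) $f$ has globally Lipschitz-continuous gradient. One has (1) $\Rightarrow$ (2) $\Leftrightarrow$ (3) $\Rightarrow$ (4) $\Leftarrow$ (5). (vii) Suppose in addition that the iterates remain bounded (as is the case when $\varphi$ is coercive), and let $\omega$ be the set of limit points of $(\bar x^k)_{k\in\mathbb{N}}$. Then: (a)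 if the iterates $\bar x^k$ are $\delta$-stationary for the proximal subproblem (as defined in the context, for some $\delta>0$) and $\mathrm{graph}\,\partial g$ is closed relative to $\mathrm{dom}\,g\times\mathbb{R}^n$, then $\omega$ is made of $\delta$-stationary points for $\varphi$, i.e. every $x^\star\in\omega$ satisfies $\mathrm{dist}(0,\partial\varphi(x^\star))\le\delta$; (b) if the sequence $(\bar x^k)_{k\in\mathbb{N}}$ is (eventually) uniformly locally optimal (as defined in the context; this being true in case of exact proximal evaluations, having $r=\infty$ and $\varepsilon_k=0$ in this case), then $\omega$ is made of stationary points for $\varphi$, i.e. every $x^\star\in\omega$ satisfies $0\in\partial\varphi(x^\star)$, and $\varphi$ is constantly equal to $\varphi_\star$ (the limit in (i)) on $\omega$.
   Context: Standing assumptions: $f:\mathbb{R}^n\to\mathbb{R}$ is differentiable with locally Lipschitz-continuous gradient; $g:\mathbb{R}^n\to\mathbb{R}\cup\{\infty\}$ is proper, lower semicontinuous and $\gamma_g$-prox-bounded, meaning that $\gamma_g\in(0,\infty]$ is the supremum of all $\gamma>0$ for which $g+\tfrac1{2\gamma}\|\cdot\|^2$ is bounded below on $\mathbb{R}^n$; $\varphi:=f+g$ satisfies $\inf\varphi>-\infty$. Write $\mathrm{dom}\,g=\{x:g(x)<\infty\}$. A function $h$ is coercive if $h(x)\to\infty$ as $\|x\|\to\infty$. Subdifferentials: for $h:\mathbb{R}^n\to\mathbb{R}\cup\{\infty\}$, the regular (Fréchet) subdifferential $\hat\partial h(\bar x)$ at $\bar x\in\mathrm{dom}\,h$ is the set of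 $v$ with $\liminf_{x\to\bar x,\,x\ne\bar x}\frac{h(x)-h(\bar x)-\langle v,x-\bar x\rangle}{\|x-\bar x\|}\ge0$ (empty outside $\mathrm{dom}\,h$); the limiting subdifferential $\partial h(\bar x)$, for $\bar x\in\mathrm{dom}\,h$, is the set of $v$ for which there exist $x^k,v^k$ with $v^k\in\hat\partial h(x^k)$ and $(x^k,v^k,h(x^k))\to(\bar x,v,h(\bar x))$ (empty outside $\mathrm{dom}\,h$). $\mathrm{graph}\,\partial g=\{(x,v):v\in\partial g(x)\}$. For $b>0$ define $\mathcal L_b(x,z,y):=f(x)+g(z)+\langle y,x-z\rangle+\tfrac b2\|x-z\|^2$. Inexact adaptive proximal gradient method. Inputs: $x^0\in\mathbb{R}^n$, $\gamma_0\in(0,\gamma_g)$, $\alpha\in(0,1)$. Initialize $\bar x^{-1}=x^0$, $k=0$, and start from Step 2. For $k=0,1,2,\dots$: Step 1. Set $\gamma_k\leftarrow\gamma_{k-1}$ and $x^k\leftarrow\bar x^{k-1}$. Step 2. Let $\bar x^k$ be a suboptimal minimizer of $\mathcal L_{1/\gamma_k}(x^k,\cdot,-\nabla f(x^k))$ such that $$\Phi_k:=\mathcal L_{1/\gamma_k}\big(x^k,\bar x^k,-\nabla f(x^k)\big)\le\mathcal L_{1/\gamma_k}\big(x^k,\bar x^{k-1},-\nabla f(x^k)\big).$$ (No (sub)optimality other than this inequality is required. Any exact minimizer of $\mathcal L_{1/\gamma_k}(x^k,\cdot,-\nabla f(x^k))$, i.e. any $\bar x^k\in\mathrm{prox}_{\gamma_k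 g}(x^k-\gamma_k\nabla f(x^k))$, where $\mathrm{prox}_{\gamma g}(u)=\arg\min_z\{g(z)+\tfrac1{2\gamma}\|z-u\|^2\}$, is admissible.) Step 3. If $f(\bar x^k)>f(x^k)+\langle\nabla f(x^k),\bar x^k-x^k\rangle+\tfrac{\alpha}{2\gamma_k}\|\bar x^k-x^k\|^2$, then set $\gamma_k\leftarrow\gamma_k/2$ and go back to Step 2. Step 4. Set $k\leftarrow k+1$ and start the next iteration at Step 1. After iteration $k$ is completed, $x^k,\bar x^k,\gamma_k,\Phi_k$ denote the final accepted values. It is assumed that $x^k\ne\bar x^k$ always holds. Suboptimality criteria for the computed $\bar x^k$: - $\delta$-stationary (for some $\delta>0$): $\mathrm{dist}\big(0,\partial[\mathcal L_{1/\gamma_k}(x^k,\cdot,-\nabla f(x^k))](\bar x^k)\big)\le\delta$, that is, there exists $\bar v^k\in\partial g(\bar x^k)$ such that $\|\bar v^k+\nabla f(x^k)+\tfrac1{\gamma_k}(\bar x^k-x^k)\|\le\delta$. - Uniformly locally optimal: there exist $r>0$ and a sequence $\varepsilon_k\searrow0$ such that $\mathcal L_{1/\gamma_k}(x^k,\bar x^k,-\nabla f(x^k))\le\mathcal L_{1/\gamma_k}(x^k,x,-\nabla f(x^k))+\varepsilon_k$ for all $x$ with $\|x-\bar x^k\|\le r$.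
   Formalization: In (iii), connectedness of the set of limit points is proved when that set is bounded, since it can fail otherwise (n≥2); and Step 2 points (rejected trials too) must have finite subproblem value, which only matters while the previous point lies outside dom g, where (i) could fail. *)

(* Defs.v *)
From mathcomp Require Import all_boot all_order all_algebra.
From mathcomp Require Import all_classical all_reals all_analysis.

Set Implicit Arguments.
Unset Strict Implicit.
Unset Printing Implicit Defensive.
Import Order.TTheory GRing.Theory Num.Theory.
Import numFieldNormedType.Exports.
Local Open Scope classical_set_scope.
Local Open Scope ring_scope.

(* The library norm `|x| on 'rV[R]_n is the sup norm.  All quantitative
   expressions below use the Euclidean norm [enorm]; only topological notions
   (limits, closedness, boundedness, differentiability), which do not depend on
   the choice of the norm, are taken from the library. *)

Section Euclidean.
Context {R : realType} {n : nat}.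
Implicit Types (x y v : 'rV[R]_n) (f : 'rV[R]_n -> R) (S : set 'rV[R]_n).

Definition dotv x y : R := \sum_i x 0 i * y 0 i.

Definition enorm x : R := Num.sqrt (dotv x x).

(* Equal to +oo when S is empty. *)
Definition edist x S : \bar R := ereal_inf [set (enorm (x - y))%:E | y in S].

Definition grad f x : 'rV[R]_n := \row_i 'D_(delta_mx 0 i) f x.

Definition lipschitz_grad_on f S : Prop :=
  exists L : R, forall x y, S x -> S y ->
    enorm (grad f x - grad f y) <= L * enorm (x - y).

Definition locally_lipschitz_grad f : Prop :=
  forall x, exists2 V, nbhs x V & lipschitz_grad_on f V.

End Euclidean.

(* Functions R^n -> R U {oo} are maps h to \bar R; the value -oo is excluded by
   [never_ninfty]. *)
Section ExtendedValued.
Context {R : realType} {n : nat}.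
Implicit Types (h g : 'rV[R]_n -> \bar R) (x v : 'rV[R]_n).

Definition never_ninfty h : Prop := forall x, (-oo < h x)%E.

Definition edom h : set 'rV[R]_n := [set x | (h x < +oo)%E].

Definition proper_function h : Prop := never_ninfty h /\ edom h !=set0.

Definition bounded_below h : Prop := exists c : R, forall x, (c%:E <= h x)%E.

(* The lower bound 0 < gammag makes the set nonempty, as ereal_sup set0 = -oo;
   gammag = +oo is allowed. *)
Definition prox_bounded (gammag : \bar R) g : Prop :=
  (0 < gammag)%E /\
  gammag = ereal_sup [set gam%:E | gam in [set gam : R | 0 < gam /\
    bounded_below (fun x => g x + (1 / (2 * gam) * enorm x ^+ 2)%:E)%E]].

Definition coercive h : Prop :=
  forall M : R, exists r : R, forall x, r < enorm x -> (M%:E <= h x)%E.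

Definition level_bounded h : Prop :=
  forall c : R, bounded_set [set x | (h x <= c%:E)%E].

Definition regular_subdiff h x : set 'rV[R]_n :=
  [set v | edom h x /\
    (0 <= limf_einf (fun y => (h y - h x - (dotv v (y - x))%:E) *
                              ((enorm (y - x))^-1)%:E) (dnbhs x))%E].

Definition limiting_subdiff h x : set 'rV[R]_n :=
  [set v | edom h x /\
    exists xs vs : nat -> 'rV[R]_n,
      [/\ forall k, regular_subdiff h (xs k) (vs k),
          xs @ \oo --> x,
          vs @ \oo --> v
        & h (xs k) @[k --> \oo] --> h x]].

Definition delta_stationary (delta : R) h x : Prop :=
  (edist 0 (limiting_subdiff h x) <= delta%:E)%E.

Definition subdiff_graph h : set ('rV[R]_n * 'rV[R]_n) :=
  [set p | limiting_subdiff h p.1 p.2].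

Definition closed_relative_to (T : topologicalType) (D A : set T) : Prop :=
  exists2 C : set T, closed C & A = C `&` D.

Definition prox (gam : R) g (u : 'rV[R]_n) : set 'rV[R]_n :=
  [set z | forall w, (g z + (1 / (2 * gam) * enorm (z - u) ^+ 2)%:E <=
                      g w + (1 / (2 * gam) * enorm (w - u) ^+ 2)%:E)%E].

Definition limit_points (u : nat -> 'rV[R]_n) : set 'rV[R]_n :=
  cluster (u @ \oo).

End ExtendedValued.

Section Algorithm.
Context {R : realType} {n : nat}.
Variables (f : 'rV[R]_n -> R) (g : 'rV[R]_n -> \bar R).
Implicit Types (x xbar z y : 'rV[R]_n) (gam alpha : R).

Definition cost x : \bar R := ((f x)%:E + g x)%E.

Definition lagrangian (b : R) x z y : \bar R :=
  ((f x)%:E + g z + (dotv y (x - z))%:E + (b / 2 * enorm (x - z) ^+ 2)%:E)%E.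

Definition subproblem gam x : 'rV[R]_n -> \bar R :=
  fun z => lagrangian (1 / gam) x z (- grad f x).

(* A suboptimal minimizer is understood to lie in the domain of the function
   being minimized.  The first clause is implied by the second one unless
   g xprev = +oo, which can only happen in the first iteration, for a starting
   point outside of the domain of g. *)
Definition suboptimal gam x xprev xbar : Prop :=
  (subproblem gam x xbar < +oo)%E /\
  (subproblem gam x xbar <= subproblem gam x xprev)%E.

Definition sufficient_decrease alpha gam x xbar : Prop :=
  f xbar <= f x + dotv (grad f x) (xbar - x)
            + alpha / (2 * gam) * enorm (xbar - x) ^+ 2.

(* [backtracking alpha x xprev gam gam' xbar]: the inner loop of Steps 2-3,
   entered with stepsize gam, may terminate with stepsize gam' and point xbar;
   every rejected trial z was itself a suboptimal minimizer. *)
Inductive backtracking alpha x xprev : R -> R -> 'rV[R]_n -> Prop :=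
| Accept gam xbar :
    suboptimal gam x xprev xbar ->
    sufficient_decrease alpha gam x xbar ->
    backtracking alpha x xprev gam gam xbar
| Reject gam z gam' xbar :
    suboptimal gam x xprev z ->
    ~ sufficient_decrease alpha gam x z ->
    backtracking alpha x xprev (gam / 2) gam' xbar ->
    backtracking alpha x xprev gam gam' xbar.

(* u (k - 1), with t0 in the role of u (-1). *)
Definition previous (T : Type) (t0 : T) (u : nat -> T) (k : nat) : T :=
  if k is k'.+1 then u k' else t0.

(* xs k, xbars k, gams k are the values accepted at iteration k; the input
   stepsize gam0 may differ from gams 0. *)
Record iapg_run alpha (x0 : 'rV[R]_n) (gam0 : R)
    (xs xbars : nat -> 'rV[R]_n) (gams : nat -> R) : Prop := IAPGRun {
  run_start : forall k, xs k = previous x0 xbars k;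
  run_loop : forall k, backtracking alpha (xs k) (previous x0 xbars k)
                         (previous gam0 gams k) (gams k) (xbars k);
  run_neq : forall k, xs k <> xbars k
}.

(* r = +oo is allowed; nonincreasing convergence to 0 forces eps k >= 0. *)
Definition eventually_locally_optimal (r : \bar R) (eps : nat -> R)
    (xs xbars : nat -> 'rV[R]_n) (gams : nat -> R) : Prop :=
  [/\ (0 < r)%E, nonincreasing_seq eps, eps @ \oo --> (0 : R)
    & \forall k \near \oo, forall z, ((enorm (z - xbars k))%:E <= r)%E ->
        (subproblem (gams k) (xs k) (xbars k) <=
         subproblem (gams k) (xs k) z + (eps k)%:E)%E].

End Algorithm.

(* Main.v *)
Require Import Defs.
From mathcomp Require Import all_boot all_order all_algebra.
From mathcomp Require Import all_classical all_reals all_analysis.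
From mathcomp Require Import ring lra.
Set Implicit Arguments.
Unset Strict Implicit.
Unset Printing Implicit Defensive.
Import Order.TTheory GRing.Theory Num.Theory.
Import numFieldNormedType.Exports.
Local Open Scope classical_set_scope.
Local Open Scope ring_scope.

(** Two scalar sequences carry the whole argument: the accepted values
    Phi_k of the proximal subproblems and the costs phi(xbar^k).  The acceptance
    test of the line search bounds phi(xbar^k) by Phi_k minus a multiple of
    |xbar^k - x^k|^2 / gamma_k, and since x^{k+1} = xbar^k is itself an admissible
    competitor in the next subproblem, Phi_{k+1} <= phi(xbar^k).  So Phi_k
    decreases, is bounded below by inf phi, and its decrements telescope.  Hence it
    converges, the sum of |xbar^k - x^k|^2 / gamma_k is finite and, as the
    stepsizes do not grow, the steps vanish ([cost_bar_le],
    [subproblem_value_next], [gap_cvg0]).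

    The set of limit points of a sequence with vanishing steps is connected when
    bounded: if it split into two pieces, one of them compact, the sequence would
    leave a small neighbourhood of that piece infinitely often, by tiny steps, and
    the exit points would accumulate strictly between the two pieces
    ([connected_limit_points]).

    A trial point is rejected only if the first-order Taylor remainder of f
    exceeds alpha / (2 gamma) |z - x|^2.  With a globally Lipschitz gradient this
    forces gamma to be bounded away from 0.  If only the iterates are bounded,
    prox-boundedness makes the trial points approach x as gamma tends to 0, so that
    the remainder bound near a compact set suffices
    ([rejected_stepsize_bounded]).  Stepsizes that are halved only while above a
    threshold are eventually constant ([stepsizes_eventually_constant]).

    If the stepsizes were summable, then, because 2 |d| <= gamma + |d|^2 / gamma,
    the steps d would be summable too, the iterates bounded, and the stepsizes
    eventually constant and positive, a contradiction ([sum_gams_unbounded]).  If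
    |d| / gamma stayed above a positive constant, the stepsizes would be dominated
    by the summable |d|^2 / gamma; so its lower limit is 0.

    For bounded iterates, the stepsize along a subsequence converging to a limit
    point x is a constant gamma, and lower semicontinuity gives phi(x) <= phistar.
    The sum rule for a smooth summand turns delta-stationarity for the subproblem
    into subgradients of g at xbar^k, to which the closed graph applies
    ([limit_point_delta_stationary]).  Uniform local optimality passes to the
    limit: x minimizes locally the subproblem centred at x itself, whose value at x is phi(x)
    ([limit_point_local_min]); hence phi(x) = phistar, and 0 is a regular
    subgradient because the model and f agree to first order. *)

(** * Euclidean inner product and norm *)

Section EuclideanNorm.
Context {R : realType} {n : nat}.
Implicit Types (x y v : 'rV[R]_n).

Lemma dotvC x y : dotv x y = dotv y x.
Proof. by apply: eq_bigr => i _; rewrite mulrC. Qed.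

Lemma dotvDl x y v : dotv (x + y) v = dotv x v + dotv y v.
Proof. by rewrite -big_split; apply: eq_bigr => i _; rewrite !mxE mulrDl. Qed.

Lemma dotvZl a x y : dotv (a *: x) y = a * dotv x y.
Proof. by rewrite mulr_sumr; apply: eq_bigr => i _; rewrite !mxE mulrA. Qed.

Lemma dotvNl x y : dotv (- x) y = - dotv x y.
Proof. by rewrite -scaleN1r dotvZl mulN1r. Qed.

Lemma dotvBl x y v : dotv (x - y) v = dotv x v - dotv y v.
Proof. by rewrite dotvDl dotvNl. Qed.

Lemma dotvDr x y v : dotv v (x + y) = dotv v x + dotv v y.
Proof. by rewrite !(dotvC v) dotvDl. Qed.

Lemma dotvZr a x y : dotv x (a *: y) = a * dotv x y.
Proof. by rewrite !(dotvC x) dotvZl. Qed.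

Lemma dotvNr x y : dotv x (- y) = - dotv x y.
Proof. by rewrite !(dotvC x) dotvNl. Qed.

Lemma dotvBr x y v : dotv v (x - y) = dotv v x - dotv v y.
Proof. by rewrite dotvDr dotvNr. Qed.

Lemma dotv0l x : dotv 0 x = 0.
Proof. by rewrite -(scale0r 0) dotvZl mul0r. Qed.

Lemma dotv_ge0 x : 0 <= dotv x x.
Proof. by apply: sumr_ge0 => i _; rewrite -expr2 sqr_ge0. Qed.

Lemma enorm_ge0 x : 0 <= enorm x.
Proof. exact: sqrtr_ge0. Qed.

Lemma sqr_enorm x : enorm x ^+ 2 = dotv x x.
Proof. by rewrite sqr_sqrtr ?dotv_ge0. Qed.

Lemma enorm_le x c : 0 <= c -> dotv x x <= c ^+ 2 -> enorm x <= c.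
Proof.
by move=> c0 h; rewrite -(ger0_norm c0) -sqrtr_sqr ler_wsqrtr.
Qed.

Lemma enormN x : enorm (- x) = enorm x.
Proof. by rewrite /enorm dotvNl dotvNr opprK. Qed.

Lemma enormBC x y : enorm (x - y) = enorm (y - x).
Proof. by rewrite -enormN opprB. Qed.

Lemma enorm0 : enorm (0 : 'rV[R]_n) = 0.
Proof. by rewrite /enorm dotv0l sqrtr0. Qed.

Lemma enormZ a x : enorm (a *: x) = `|a| * enorm x.
Proof.
by rewrite /enorm dotvZl dotvZr mulrA -expr2 sqrtrM ?sqr_ge0// sqrtr_sqr.
Qed.

(** The topology of ['rV[R]_n] is that of the sup norm; this bound and
    [enorm_le_normr] transfer limits and boundedness between the two norms. *)
Lemma normr_le_enorm x : `|x| <= enorm x.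
Proof.
rewrite [`|x|]mx_normrE; apply: bigmax_le; first exact: enorm_ge0.
move=> [i j] _ /=; rewrite (ord1 i) -sqrtr_sqr ler_wsqrtr//.
rewrite /dotv (bigD1 j)//= -expr2 lerDl.
by apply: sumr_ge0 => k _; rewrite -expr2 sqr_ge0.
Qed.

Lemma normr_coord_le x i : `|x 0 i| <= `|x|.
Proof.
rewrite [`|x|]mx_normrE.
exact: (le_bigmax _ (fun ij : 'I_1 * 'I_n => `|x ij.1 ij.2|) (0, i)).
Qed.

Lemma enorm_le_normr x : enorm x <= n%:R * `|x|.
Proof.
apply: enorm_le; first by rewrite mulr_ge0.
rewrite (@le_trans _ _ (\sum_(i < n) `|x| ^+ 2))//.
  apply: ler_sum => i _; rewrite -expr2 -real_normK ?num_real//.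
  by rewrite ler_sqr ?nnegrE// normr_coord_le.
rewrite sumr_const card_ord exprMn -[leLHS]mulr_natl ler_wpM2r ?sqr_ge0//.
by rewrite -natrX ler_nat; case: (n) => // m; rewrite leq_pmulr.
Qed.

Lemma enorm_gt0 x : (0 < enorm x) = (x != 0).
Proof.
apply/idP/idP => [|x0]; first by apply: contraTneq => ->; rewrite enorm0 ltxx.
by rewrite (lt_le_trans _ (normr_le_enorm x)) ?normr_gt0.
Qed.

Lemma dotv_le_enorm x y : dotv x y <= enorm x * enorm y.
Proof.
have [->|] := eqVneq y 0; first by rewrite dotvC dotv0l enorm0 mulr0.
rewrite -enorm_gt0 => y0; have yy : 0 < dotv y y by rewrite -sqr_enorm exprn_gt0.
apply: (le_trans (ler_norm _)); rewrite -sqrtr_sqr -sqrtrM ?dotv_ge0//.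
apply: ler_wsqrtr.
(* the squared norm of the projection residual, cleared of fractions *)
have := dotv_ge0 (dotv y y *: x - dotv x y *: y).
rewrite !(dotvBl, dotvBr, dotvZl, dotvZr) (dotvC y x) => h.
by rewrite -(ler_pM2l yy); nra.
Qed.

Lemma sqr_enormD x y :
  enorm (x + y) ^+ 2 = enorm x ^+ 2 + 2 * dotv x y + enorm y ^+ 2.
Proof. by rewrite !sqr_enorm dotvDl !dotvDr (dotvC y x); ring. Qed.

Section Limits.
Context {T : Type} {F : set_system T} {FF : Filter F}.
Implicit Types (u w : T -> 'rV[R]_n).

Lemma cvg_dotv u w x y :
  u @ F --> x -> w @ F --> y -> dotv (u t) (w t) @[t --> F] --> dotv x y.
Proof.
move=> ux wy; apply: cvg_big => [|i _]; first exact: add_continuous.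
apply: cvgM.
  apply: (@continuous_cvg _ _ _ _ _ u (fun M : 'rV[R]_n => M 0 i) _ _ ux).
  exact: coord_continuous.
apply: (@continuous_cvg _ _ _ _ _ w (fun M : 'rV[R]_n => M 0 i) _ _ wy).
exact: coord_continuous.
Qed.

Lemma cvg_enorm u x : u @ F --> x -> enorm (u t) @[t --> F] --> enorm x.
Proof.
move=> ux; apply: (@continuous_cvg _ _ _ _ _ (fun t => dotv (u t) (u t))
  Num.sqrt _ _ (cvg_dotv ux ux)).
exact: sqrt_continuous.
Qed.

Lemma enorm_cvg0 u : enorm (u t) @[t --> F] --> (0 : R) -> u @ F --> (0 : 'rV[R]_n).
Proof.
move=> u0; apply: norm_cvg0; apply: (squeeze_cvgr _ (cvg_cst 0) u0).
by apply: nearW => t; rewrite normr_ge0 normr_le_enorm.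
Qed.

End Limits.

End EuclideanNorm.

(** * Gradients and Taylor remainders *)

Section Gradient.
Context {R : realType} {n : nat}.
Variable f : 'rV[R]_n -> R.
Implicit Types (x y z v : 'rV[R]_n).

(** The quantity that the acceptance test of the line search compares with
    alpha / (2 gamma) |z - x|^2. *)
Definition taylor_rest x z : R := f z - f x - dotv (grad f x) (z - x).

Lemma derive_grad x v : differentiable f x -> 'D_v f x = dotv (grad f x) v.
Proof.
move=> df; rewrite deriveE// {1}[v]row_sum_delta linear_sum.
by apply: eq_bigr => i _; rewrite linearZ/= mxE deriveE// mulrC.
Qed.

Lemma normr_dotv_le x y : `|dotv x y| <= enorm x * enorm y.
Proof.
rewrite ler_norml dotv_le_enorm andbT lerNl -dotvNl -(enormN x).
exact: dotv_le_enorm.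
Qed.

Hypothesis f_diff : forall x, differentiable f x.

Lemma mean_value x z : exists2 t : R, 0 <= t <= 1 &
  f z - f x = dotv (grad f (x + t *: (z - x))) (z - x).
Proof.
pose phi (t : R) := f (x + t *: (z - x)).
have phi_der (t : R) : is_derive t 1 phi (dotv (grad f (x + t *: (z - x))) (z - x)).
  have E : (fun h : R => h^-1 *: (phi (h *: 1 + t) - phi t)) =
     (fun h : R => h^-1 *: (f (h *: (z - x) + (x + t *: (z - x)))
                            - f (x + t *: (z - x)))).
    apply/funext => h; rewrite /phi; congr (_ *: (f _ - _)).
    by rewrite [h *: 1]mulr1 scalerDl addrCA.
  apply: DeriveDef; rewrite /derivable /derive E.
    exact: diff_derivable.
  by rewrite -derive_grad.
have [|t] := @MVT_segment R phi _ 0 1 ler01 (fun t _ => phi_der t).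
  apply: derivable_within_continuous => t _.
  by have /@ex_derive := phi_der t.
rewrite in_itv /= => t01 E; exists t => //.
by move: E; rewrite /phi scale1r scale0r addr0 subr0 mulr1 subrKC.
Qed.

(** By the mean value theorem the remainder is the inner product of z - x with a
    gradient increment along the segment. *)
Lemma taylor_rest_le (L : R) x z : 0 <= L ->
  (forall t, 0 <= t <= 1 ->
     enorm (grad f (x + t *: (z - x)) - grad f x) <= L * enorm (t *: (z - x))) ->
  `|taylor_rest x z| <= L * enorm (z - x) ^+ 2.
Proof.
move=> L0 hL; have [t t01 E] := mean_value x z.
rewrite /taylor_rest E -dotvBl (le_trans (normr_dotv_le _ _))//.
rewrite expr2 mulrA ler_wpM2r ?enorm_ge0// (le_trans (hL t t01))//.
rewrite ler_wpM2l// enormZ; case/andP: t01 => t0 t1.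
by rewrite ger0_norm// ler_piMl ?enorm_ge0.
Qed.

Lemma taylor_rest_lipschitz : lipschitz_grad_on f setT ->
  exists2 L, 0 <= L & forall x z, taylor_rest x z <= L * enorm (z - x) ^+ 2.
Proof.
move=> [L hL]; exists `|L|; first exact: normr_ge0.
move=> x z; apply: le_trans (ler_norm _) _.
apply: taylor_rest_le => // t _; apply: le_trans (hL _ _ I I) _.
by rewrite [x + _]addrC addrK ler_wpM2r ?enorm_ge0 ?ler_norm.
Qed.

Hypothesis f_lip : locally_lipschitz_grad f.

Lemma taylor_rest_local x : exists2 e : R, 0 < e & exists2 L, 0 <= L &
  forall y z, `|x - y| < e -> `|x - z| < e ->
    `|taylor_rest y z| <= L * enorm (z - y) ^+ 2.
Proof.
have [V Vx [L hL]] := f_lip x.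
move/nbhs_ballP: Vx => [e /= e0 eV]; exists e => //.
exists `|L|; first exact: normr_ge0.
move=> y z xy xz; apply: taylor_rest_le => // t /andP[t0 t1].
have Vy : V y by apply: eV; rewrite -ball_normE.
have Vt : V (y + t *: (z - y)).
  apply: eV; rewrite -ball_normE /=.
  have -> : x - (y + t *: (z - y)) = (1 - t) *: (x - y) + t *: (x - z).
    by apply/rowP => i; rewrite !mxE; ring.
  apply: le_lt_trans (ler_normD _ _) _; rewrite !normrZ !ger0_norm ?subr_ge0//.
  have [->|t_gt0] : t = 0 \/ 0 < t by move: t0; rewrite le_eqVlt => /orP[/eqP|]; auto.
    by rewrite subr0 mul1r mul0r addr0.
  by nra.
apply: le_trans (hL _ _ Vt Vy) _.
by rewrite [y + _]addrC addrK ler_wpM2r ?enorm_ge0 ?ler_norm.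
Qed.

Lemma cvg_grad x : grad f y @[y --> x] --> grad f x.
Proof.
have [V Vx [L hL]] := f_lip x.
suff : grad f y - grad f x @[y --> x] --> (0 : 'rV[R]_n) by move/subr_cvg0.
apply: (@enorm_cvg0 _ _ _ (nbhs x)).
have c0 : L * enorm (y - x) @[y --> x] --> 0.
  rewrite -(mulr0 L) -(enorm0 (n := n)) -(subrr x).
  apply: (@cvgMr _ _ (nbhs x)).
  by apply: (@cvg_enorm _ _ _ (nbhs x) _ (fun y => y - x)); apply: cvgB;
    [exact: cvg_id|exact: cvg_cst].
apply: (squeeze_cvgr _ (cvg_cst 0) c0).
near=> y; rewrite enorm_ge0 hL//; last exact: nbhs_singleton.
by near: y.
Unshelve. all: by end_near. Qed.

(** A single number e serves both as the radius and, through its inverse, as the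
    constant, so that the condition is monotone in e and the local bounds patch
    together by compactness. *)
Lemma taylor_rest_compact (K : set 'rV[R]_n) : compact K ->
  exists2 e : R, 0 < e & forall x z, K x -> enorm (z - x) <= e ->
    taylor_rest x z <= e^-1 * enorm (z - x) ^+ 2.
Proof.
move=> /compact_near_coveringP cK.
have [] := @cK R 0^'+ (fun e x => forall z, enorm (z - x) <= e ->
    taylor_rest x z <= e^-1 * enorm (z - x) ^+ 2) _.
  move=> x _; have [e e0 [L L0 hL]] := taylor_rest_local x.
  have e20 : 0 < e / 2 by rewrite divr_gt0.
  exists (ball x (e / 2), [set i | 0 < i < e / 2 /\ i < (L + 1)^-1]).
    split => /=; first exact: nbhsx_ballx.
    near=> i; split; last first.
      by near: i; apply: nbhs_right_lt; rewrite invr_gt0 ltr_wpDl.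
    apply/andP; split; first by near: i; exact: nbhs_right_gt.
    by near: i; apply: nbhs_right_lt.
  move=> [y i] /= [] /=; rewrite -ball_normE /= => xy [/andP[i0 ie] iL] z zy.
  have xz : `|x - z| < e.
    rewrite (splitr e) -(subrKA y) (le_lt_trans (ler_normD _ _))// ltrD//.
    rewrite distrC (le_lt_trans (normr_le_enorm _))//.
    exact: le_lt_trans ie.
  apply: le_trans (ler_norm _) _.
  apply: le_trans (hL y z _ xz) _; first by rewrite (lt_le_trans xy)//; lra.
  rewrite ler_wpM2r ?sqr_ge0// (@le_trans _ _ (L + 1))//; first by lra.
  by rewrite -[leLHS]invrK lef_pV2 ?posrE ?invr_gt0 ?ltW//; lra.
move=> e /= e0 he; exists (e / 2); first by rewrite divr_gt0.
move=> x z Kx; apply: he => //=; last by rewrite divr_gt0.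
by rewrite sub0r normrN ger0_norm ?divr_ge0 ?ltW// ltr_pdivrMr// mulr_natr mulr2n ltrDl.
Unshelve. all: by end_near. Qed.

End Gradient.

(** * Subdifferentials and the smooth sum rule *)

Section Subdifferentials.
Context {R : realType} {n : nat}.
Implicit Types (h : 'rV[R]_n -> \bar R) (s : 'rV[R]_n -> R) (x y z v p : 'rV[R]_n).

Lemma near_enorm_lt x (e : R) : 0 < e -> \forall y \near x, enorm (y - x) < e.
Proof.
move=> e0.
have c : enorm (y - x) @[y --> x] --> (0 : R).
  rewrite -(enorm0 (n := n)) -(subrr x).
  apply: (@cvg_enorm _ _ _ (nbhs x) _ (fun y => y - x)).
  by apply: cvgB; [exact: cvg_id|exact: cvg_cst].
by near=> y; near: y; apply: (cvgr_lt 0 c).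
Unshelve. all: by end_near. Qed.

Lemma edom_fin_num h x : never_ninfty h -> edom h x -> h x \is a fin_num.
Proof. by move=> hN hx; rewrite fin_real// hN hx. Qed.

(** Clearing the denominator in the lower limit: v is a regular subgradient when
    h has the affine minorant with slope v up to an error o(|y - x|). *)
Lemma regular_subdiffP h x v : never_ninfty h ->
  regular_subdiff h x v <-> edom h x /\ forall e : R, 0 < e ->
    \forall y \near x, (h x + (dotv v (y - x) - e * enorm (y - x))%:E <= h y)%E.
Proof.
move=> hN; split=> -[hx H]; split=> //.
  move=> e e0; move: H; rewrite limf_einfE => H.
  have /ereal_sup_gt[_ /= [V VF <-] eV] : ((- e)%:E < ereal_sup [set
      ereal_inf [set ((h y - h x - (dotv v (y - x))%:E) *
                              ((enorm (y - x))^-1)%:E)%E | y in V] | V in dnbhs x])%E.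
    by apply: lt_le_trans H; rewrite lte_fin oppr_lt0.
  move: VF; rewrite /dnbhs /= => VF.
  have := edom_fin_num hN hx; case E : (h x) => [a| |]// _.
  near=> y.
  have [->|yx] := eqVneq y x.
    by rewrite subrr enorm0 dotvC dotv0l mulr0 subr0 adde0 E.
  have Vy : V y.
    suff : y != x -> V y by apply.
    by near: y.
  have := le_trans (ltW eV) (ereal_inf_lbound (imageP _ Vy)).
  have d0 : 0 < enorm (y - x) by rewrite enorm_gt0 subr_eq0.
  have := hN y; case: (h y) => [b| |]// _; last by rewrite leey.
  rewrite E -!EFinB -EFinM -!EFinD !lee_fin ler_pdivlMr// mulNr; lra.
rewrite limf_einfE; apply/lee_addgt0Pr => e e0.
have {}H := H e e0.
suff : ((- e)%:E <= ereal_sup [set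
      ereal_inf [set ((h y - h x - (dotv v (y - x))%:E) *
                              ((enorm (y - x))^-1)%:E)%E | y in V] | V in dnbhs x])%E.
  case: ereal_sup => [a| |]//; last by rewrite addye// leey.
  by rewrite -EFinD !lee_fin => ?; lra.
pose V := [set y | y != x /\ (h x + (dotv v (y - x) - e * enorm (y - x))%:E <= h y)%E].
apply: (@le_trans _ _ (ereal_inf [set ((h y - h x - (dotv v (y - x))%:E) *
                              ((enorm (y - x))^-1)%:E)%E | y in V])); last first.
  apply: ereal_sup_ubound; exists V => //.
  by rewrite /dnbhs /within /=; apply: filterS H => y hy yx; split.
apply: le_ereal_inf_tmp => _ [y [yx +] <-].
have := edom_fin_num hN hx; case E : (h x) => [a| |]// _.
have d0 : 0 < enorm (y - x) by rewrite enorm_gt0 subr_eq0.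
have := hN y; case: (h y) => [b| |]// _; last first.
  by move=> _; rewrite !addye//= gt0_mulye ?leey// lte_fin invr_gt0.
rewrite -!EFinB -EFinM -!EFinD !lee_fin ler_pdivlMr// mulNr; lra.
Unshelve. all: by end_near. Qed.

(** Fréchet differentiability of a real function with gradient p, in the form
    that combines directly with [regular_subdiffP]. *)
Definition has_gradient s x p := forall e : R, 0 < e ->
  \forall y \near x, `|s y - s x - dotv p (y - x)| <= e * enorm (y - x).

Lemma quadratic_has_gradient s x p (L e : R) : 0 < e -> 0 <= L ->
  (forall y, `|x - y| < e ->
     `|s y - s x - dotv p (y - x)| <= L * enorm (y - x) ^+ 2) ->
  has_gradient s x p.
Proof.
move=> e0 L0 hL d d0.
have xe : \forall y \near x, `|x - y| < e.
  by have := nbhsx_ballx x e e0; rewrite -ball_normE.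
near=> y.
rewrite (le_trans (hL y _))//.
rewrite expr2 mulrA ler_wpM2r ?enorm_ge0//.
have yd : enorm (y - x) < d / (L + 1).
  by near: y; apply: near_enorm_lt; rewrite divr_gt0// ltr_wpDl.
have L10 : 0 < L + 1 by rewrite ltr_wpDl.
move: yd; rewrite ltr_pdivlMr// => yd; have := enorm_ge0 (y - x); nra.
Unshelve. all: by end_near. Qed.

Lemma has_gradientN s x p : has_gradient s x p -> has_gradient (fun y => - s y) x (- p).
Proof.
move=> sp e e0; apply: filterS (sp e e0) => y.
by rewrite -normrN dotvNl !opprB !opprK [X in `|X|](_ : _ = - s y + s x + dotv p (y - x))//; ring.
Qed.

Lemma has_gradient_cvg s x p : has_gradient s x p -> s y @[y --> x] --> s x.
Proof.
move=> sp; apply/(@cvgrPdist_lt _ _ _ (nbhs x)) => e e0; near=> y.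
have H : `|s y - s x - dotv p (y - x)| <= 1 * enorm (y - x).
  by near: y; exact: sp.
have := normr_dotv_le p (y - x).
have : enorm (y - x) < e / (1 + enorm p).
  by near: y; apply: near_enorm_lt; rewrite divr_gt0// ltr_pwDl// enorm_ge0.
rewrite ltr_pdivlMr ?ltr_pwDl ?enorm_ge0// => yd pd.
rewrite distrC -(subrK (dotv p (y - x)) (s y - s x)).
apply: le_lt_trans (ler_normD _ _) _; lra.
Unshelve. all: by end_near. Qed.

Lemma never_ninftyD s h : never_ninfty h -> never_ninfty (fun y => (s y)%:E + h y)%E.
Proof. by move=> hN y; move: (hN y); case: (h y) => //= r _; rewrite ltNyr. Qed.

Lemma edomD s h x : edom h x -> edom (fun y => (s y)%:E + h y)%E x.
Proof. by rewrite /edom /=; case: (h x) => //= r _; rewrite ltry. Qed.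

Lemma regular_subdiffD s h x p v : never_ninfty h -> has_gradient s x p ->
  regular_subdiff h x v ->
  regular_subdiff (fun y => (s y)%:E + h y)%E x (p + v).
Proof.
move=> hN sp /(regular_subdiffP _ _ hN)[hx H].
apply/regular_subdiffP; first exact: never_ninftyD.
split; first exact: edomD.
move=> e e0; have e20 : 0 < e / 2 by rewrite divr_gt0.
have := edom_fin_num hN hx; case E : (h x) => [a| |]// _.
near=> y.
have : `|s y - s x - dotv p (y - x)| <= e / 2 * enorm (y - x) by near: y; exact: sp.
have : (h x + (dotv v (y - x) - e / 2 * enorm (y - x))%:E <= h y)%E by near: y; exact: H.
rewrite E; case: (h y) => [b| |]//=; last by rewrite ?addey// ?leey.
rewrite -!EFinD !lee_fin dotvDl ler_norml => ? /andP[? ?]; lra.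
Unshelve. all: by end_near. Qed.

(** The exact sum rule for a continuously differentiable summand.  Only one
    inclusion is stated: the other one is this lemma applied to - s, whose sum
    with s + h is h again. *)
Lemma limiting_subdiffD s (G : 'rV[R]_n -> 'rV[R]_n) h x v : never_ninfty h ->
  (forall y, has_gradient s y (G y)) -> G y @[y --> x] --> G x ->
  limiting_subdiff h x v ->
  limiting_subdiff (fun y => (s y)%:E + h y)%E x (G x + v).
Proof.
move=> hN sG Gx [hx [xs [vs [reg xsx vsv hxs]]]]; split; first exact: edomD.
exists xs, (fun k => G (xs k) + vs k); split => //.
- by move=> k; apply: regular_subdiffD.
- by apply: cvgD => //; exact: (@cvg_comp _ _ _ xs G _ (nbhs x) _ xsx Gx).
- apply: cvgeD => //.
  apply: cvg_EFin; first by apply: nearW => k; rewrite fin_numE.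
  exact: (@cvg_comp _ _ _ xs s _ (nbhs x) _ xsx (has_gradient_cvg (sG x))).
Qed.

Lemma regular_sub_limiting h x : regular_subdiff h x `<=` limiting_subdiff h x.
Proof.
move=> v vx; split; first by case: vx.
exists (fun=> x), (fun=> v); split; [by []|exact: cvg_cst|exact: cvg_cst|exact: cvg_cst].
Qed.

Lemma has_gradient_grad (f : 'rV[R]_n -> R) x :
  (forall x, differentiable f x) -> locally_lipschitz_grad f ->
  has_gradient f x (grad f x).
Proof.
move=> f_diff f_lip; have [e e0 [L L0 hL]] := taylor_rest_local f_diff f_lip x.
apply: (@quadratic_has_gradient _ _ _ L e) => // y xy.
by apply: hL => //; rewrite subrr normr0.
Qed.

End Subdifferentials.

(** * Limit points of sequences and nonnegative series *)

Section LimitPoints.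
Context {R : realType} {n : nat}.
Implicit Types (u w : nat -> 'rV[R]_n) (x y z : 'rV[R]_n) (s : nat -> nat).

Lemma cvg_ge_id s : (forall j, (j <= s j)%N) -> s @ \oo --> \oo.
Proof.
move=> js A [N _ NA]; exists N => // j /= Nj; apply: NA => /=.
exact: leq_trans (js j).
Qed.

Lemma cvg_subseq (T : topologicalType) (u : nat -> T) (x : T) s :
  (forall j, (j <= s j)%N) -> u @ \oo --> x -> u (s j) @[j --> \oo] --> x.
Proof. by move=> js ux; exact: cvg_comp (cvg_ge_id js) ux. Qed.

Lemma limit_points_frequently u x (e : R) N : limit_points u x -> 0 < e ->
  exists2 k, (N <= k)%N & `|u k - x| < e.
Proof.
move=> ux e0; have [||z []] := ux [set u k | k in [set k | (N <= k)%N]] (ball x e).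
- by exists N => // k /= Nk; exists k.
- exact: nbhsx_ballx.
by move=> [k /= Nk <-]; rewrite -ball_normE /= distrC => xk; exists k.
Qed.

(** Indices with j <= s j, not necessarily increasing, are enough for a
    subsequence and compose well. *)
Lemma limit_pointsP u x : limit_points u x <->
  exists2 s, (forall j, (j <= s j)%N) & u (s j) @[j --> \oo] --> x.
Proof.
split=> [ux|[s js us] A B uA xB].
  have /choice[s hs] j : exists k, (j <= k)%N /\ `|u k - x| < j.+1%:R^-1.
    by have [|k jk kx] := @limit_points_frequently u x (j.+1%:R^-1) j ux; [|exists k].
  exists s => [j|]; first by have [] := hs j.
  apply/subr_cvg0; apply: norm_cvg0.
  apply: (squeeze_cvgr _ (cvg_cst 0) (@cvg_harmonic R)).
  by apply: nearW => j; rewrite normr_ge0 ltW//; have [] := hs j.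
have sA : \forall j \near \oo, A (u (s j)) by exact: (cvg_ge_id js uA).
have sB : \forall j \near \oo, B (u (s j)) by exact: us.
near \oo => j; exists (u (s j)); split; by near: j.
Unshelve. all: by end_near. Qed.

Lemma closed_limit_points u : closed (limit_points u).
Proof.
rewrite /limit_points clusterE; apply: closed_bigI => A _.
exact: closed_closure.
Qed.

Lemma sub_limit_points u w : (fun k => u k - w k) @ \oo --> (0 : 'rV[R]_n) ->
  limit_points u `<=` limit_points w.
Proof.
move=> uw x /limit_pointsP[s js us]; apply/limit_pointsP; exists s => //.
rewrite -[x]subr0.
have -> : (fun j => w (s j)) = (fun j => u (s j) - (u (s j) - w (s j))).
  by apply/funext => j; rewrite subKr.
by apply: cvgB => //; exact: (cvg_subseq js uw).
Qed.

Lemma compact_norm_le (M : R) : compact [set z : 'rV[R]_n | `|z| <= M].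
Proof.
apply: bounded_closed_compact.
  by exists M; split; [exact: num_real|move=> r Mr z /= zM; exact: le_trans (ltW Mr)].
have -> : [set z : 'rV[R]_n | `|z| <= M] =
    ((fun z : 'rV[R]_n => `|z|) @^-1` [set r | r <= M]) by [].
apply: closed_comp => [z _|]; [exact: norm_continuous|exact: closed_le].
Qed.

Lemma bounded_limit_point u (M : R) : (forall k, `|u k| <= M) ->
  exists x, limit_points u x.
Proof.
move=> uM; have [|x [_ ux]] := @compact_norm_le M (u @ \oo) _; last by exists x.
by apply: (@filterE _ \oo) => k; exact: uM.
Qed.

Lemma first_exit (P : nat -> Prop) k m : (k <= m)%N -> P k -> ~ P m ->
  exists2 j, (k <= j)%N & P j /\ ~ P j.+1.
Proof.
move=> km Pk; rewrite -(subnKC km); elim: (m - k)%N => [|d IH].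
  by rewrite addn0 => /(_ Pk).
rewrite addnS => nP; have [Pd|/IH//] := pselect (P (k + d)%N).
by exists (k + d)%N; rewrite ?leq_addr.
Qed.

(** Otherwise the limit points split into a nonempty compact part B and a
    nonempty relatively closed rest at distance at least 2e from B.  The sequence
    enters the e-neighbourhood U of B infinitely often and leaves it infinitely
    often; the exit points are bounded, so they have a limit point x, which is
    out of U, hence out of B, and yet closer than 2e to B.  The sequence itself
    may be unbounded. *)
Lemma connected_limit_points u :
  (fun k => u k.+1 - u k) @ \oo --> (0 : 'rV[R]_n) ->
  bounded_set (limit_points u) -> connected (limit_points u).
Proof.
move=> du bA B [b Bb] [V oV BV] [C cC BC].
apply/seteqP; split; first by rewrite BV => z [].
move=> y Ay; apply: contrapT => nBy.
have cB : compact B.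
  apply: bounded_closed_compact.
    by case: bA => M [Mr hM]; exists M; split=> // r rM z; rewrite BV => -[Az _]; exact: hM Az.
  by rewrite BC; apply: closedI => //; exact: closed_limit_points.
have [e e0 eB] : exists2 e : R, 0 < e & forall c z, B c -> `|z - c| < e + e -> V z.
  have /compact_near_coveringP/(_ R 0^'+ (fun e c => forall z, `|z - c| < e -> V z)) := cB.
  case.
    move=> c Bc; have Vc : V c by move: Bc; rewrite BV => -[].
    have /nbhs_ballP[e /= e0 eV] := oV c Vc.
    exists (ball c (e / 2), [set i | i < e / 2]).
      split => /=; first by apply: nbhsx_ballx; rewrite divr_gt0.
      by apply: nbhs_right_lt; rewrite divr_gt0.
    move=> [c' i] /= [+ ie] z zc'; rewrite -ball_normE /= => cc'.
    apply: eV; rewrite -ball_normE /= (splitr e) -(subrKA c').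
    by rewrite (le_lt_trans (ler_normD _ _))// ltrD// distrC (lt_trans zc').
  move=> e /= e0 he; exists (e / 4); first by rewrite divr_gt0.
  have e20 : 0 < e / 2 by rewrite divr_gt0.
  move=> c z Bc zc; apply: (he (e / 2)) Bc _ _ => //=.
    by rewrite sub0r normrN gtr0_norm//; lra.
  by rewrite (lt_le_trans zc)//; lra.
pose U z := exists2 c, B c & `|z - c| < e.
have [N0 _ hN0] : \forall k \near \oo, `|u k.+1 - u k| < e / 2.
  have /cvgr_dist_lt/(_ (e / 2)) := du.
  by rewrite divr_gt0// => /(_ isT); apply: filterS => k; rewrite sub0r normrN.
(* the sequence is infinitely often in U, near b, and infinitely often out of
   it, near y *)
have exits j : exists k, [/\ (j <= k)%N, (N0 <= k)%N, U (u k) & ~ U (u k.+1)].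
  have Ab : limit_points u b by move: Bb; rewrite BV => -[].
  have [k1 jk1 k1b] := limit_points_frequently (maxn j N0) Ab e0.
  have [k2 k12 k2y] := limit_points_frequently k1 Ay e0.
  have [||k k1k [Uk nUk]] := first_exit (P := fun k => U (u k)) k12.
  - by exists b.
  - move=> [c Bc k2c]; apply: nBy; rewrite BV; split => //; apply: (eB c) => //.
    rewrite -(subrKA (u k2)) (le_lt_trans (ler_normD _ _))// ltrD//.
    by rewrite distrC.
  exists k; split => //; apply: leq_trans k1k; apply: leq_trans jk1.
    exact: leq_maxl.
  exact: leq_maxr.
have /choice[s hs] := exits.
have [M hM] : exists M : R, forall c, B c -> `|c| <= M.
  have [M [_ hM]] : bounded_set B by exact: compact_bounded.
  by exists (M + 1) => c Bc; apply: hM => //; rewrite ltrDl.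
have [x xlim] : exists x, limit_points (fun j => u (s j).+1) x.
  apply: (@bounded_limit_point _ (M + e + e)) => j.
  have [_ N0s [c Bc sc] _] := hs j.
  have := hN0 _ N0s; have := hM c Bc => /= cM st.
  have := ler_normD (u (s j).+1 - u (s j)) ((u (s j) - c) + c).
  have := ler_normD (u (s j) - c) c; rewrite !subrK; lra.
have [t jt ut] := (limit_pointsP _ _).1 xlim.
have Ax : limit_points u x.
  apply/limit_pointsP; exists (fun j => (s (t j)).+1) => // j.
  have [tj _ _ _] := hs (t j).
  by apply: leq_trans (jt j) _; apply: leqW.
have [J _ hJ] : \forall j \near \oo, `|x - u (s (t j)).+1| < e / 2.
  by move/cvgr_dist_lt : ut; apply; rewrite divr_gt0.
have nUx : ~ U x.
  move=> [c Bc xc].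
  have : \forall j \near \oo, `|x - u (s (t j)).+1| < e - `|x - c|.
    by move/cvgr_dist_lt : ut; apply; rewrite subr_gt0.
  move=> [j _ /(_ j (leqnn j))]; have [_ _ _ nU] := hs (t j).
  move=> H; apply: nU; exists c => //.
  rewrite -(subrKA x) (le_lt_trans (ler_normD _ _))// distrC.
  by move: H; rewrite ltrBrDr.
apply: nUx; exists x; last by rewrite subrr normr0.
rewrite BV; split => //.
have [_ N0s [c Bc sc] _] := hs (t J).
apply: (eB c) => //.
have := hJ J (leqnn J); have := hN0 _ N0s => /= h1 h2.
rewrite -(subrKA (u (s (t J)).+1)) (le_lt_trans (ler_normD _ _))//.
rewrite -(subrKA (u (s (t J))) (u (s (t J)).+1)).
have := ler_normD (u (s (t J)).+1 - u (s (t J))) (u (s (t J)) - c); lra.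
Qed.

End LimitPoints.

Section NonnegativeSeries.
Context {R : realType}.
Implicit Types (u : nat -> R).

Lemma nneseries_lt_pinftyP u : (forall k, 0 <= u k) ->
  (\sum_(0 <= k <oo) (u k)%:E < +oo)%E <->
  exists C : R, forall N, \sum_(0 <= k < N) u k <= C.
Proof.
move=> u0; split=> [h|[C hC]].
  have fn : (\sum_(0 <= k <oo) (u k)%:E)%E \is a fin_num.
    by rewrite ge0_fin_numE//; apply: nneseries_ge0 => k _ _; rewrite lee_fin.
  exists (fine (\sum_(0 <= k <oo) (u k)%:E)%E) => N.
  rewrite -lee_fin fineK// -sumEFin.
  by apply: nneseries_lim_ge => k _ _; rewrite lee_fin.
apply: (@le_lt_trans _ _ C%:E); last exact: ltry.
apply: lime_le; first by apply: is_cvg_nneseries => k _ _; rewrite lee_fin.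
by apply: nearW => N; rewrite sumEFin lee_fin.
Qed.

End NonnegativeSeries.

(** * The proximal model and the backtracking loop *)

Section Backtracking.
Context {R : realType} {n : nat}.
Variables (f : 'rV[R]_n -> R) (g : 'rV[R]_n -> \bar R).
Implicit Types (x z : 'rV[R]_n) (gam alpha : R).

(** The real-valued part of the proximal subproblem, that is, everything but
    g. *)
Definition model gam x z : R :=
  f x + dotv (grad f x) (z - x) + 1 / (2 * gam) * enorm (z - x) ^+ 2.

Lemma subproblemE gam x : subproblem f g gam x = (fun z => (model gam x z)%:E + g z)%E.
Proof.
apply/funext => z; rewrite /subproblem /lagrangian (addeAC _ (g z)) (addeAC _ (g z)) -!EFinD.
congr ((_ + _ + _ * _ ^+ 2)%:E + _)%E; last exact: enormBC.
  by rewrite dotvNl -dotvNr opprB.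
by rewrite !mul1r invfM mulrC.
Qed.

Lemma model_id gam x : model gam x x = f x.
Proof. by rewrite /model subrr enorm0 dotvC dotv0l expr0n mulr0 !addr0. Qed.

Lemma backtracking_accepted alpha x xp gam gam' xbar :
  backtracking f g alpha x xp gam gam' xbar ->
  suboptimal f g gam' x xp xbar /\ sufficient_decrease f alpha gam' x xbar.
Proof. by elim. Qed.

(** The stepsize tried just before the accepted one is the only trial that
    matters: a lower bound on it bounds the accepted stepsize from below. *)
Lemma backtracking_last_rejected alpha x xp gam gam' xbar : 0 < gam ->
  backtracking f g alpha x xp gam gam' xbar ->
  0 < gam' /\ (gam' = gam \/ exists z, [/\ 2 * gam' <= gam,
    suboptimal f g (2 * gam') x xp z & ~ sufficient_decrease f alpha (2 * gam') x z]).
Proof.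
move=> gam_gt0 b; elim: b gam_gt0 => {gam gam' xbar}
  [gam xbar _ _ gam_gt0|gam z gam' xbar sz nz _ IH gam_gt0]; first by split; [|left].
have [|gam'0 IH'] := IH; first by rewrite divr_gt0.
split=> //; right; case: IH' => [->|[w [le_w sw nw]]].
  by exists z; rewrite mulrC divfK.
by exists w; split => //; lra.
Qed.

(** A halving above the threshold c lowers the stepsize by at least c / 2, which
    a convergent sequence can do only finitely often. *)
Lemma stepsizes_eventually_constant (gams : nat -> R) (c : R) : 0 < c ->
  (forall k, 0 < gams k) ->
  (forall k, gams k.+1 = gams k \/ 2 * gams k.+1 <= gams k /\ c <= 2 * gams k.+1) ->
  exists kappa, forall k, (kappa <= k)%N -> gams k = gams kappa.
Proof.
move=> c0 gams0 step.
have noninc : nonincreasing_seq gams.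
  apply/nonincreasing_seqP => k; have := gams0 k.+1.
  by case: (step k) => [->//|[? _] ?]; lra.
have cv : cvgn gams.
  apply: nonincreasing_is_cvgn => //; exists 0 => _ [k _ <-]; exact: ltW.
have [N _ hN] : \forall k \near \oo, `|limn gams - gams k| < c / 8.
  by move/cvgr_dist_lt : cv; apply; rewrite divr_gt0.
exists N => k Nk; rewrite -(subnKC Nk); elim: (k - N)%N => [|d IH]; first by rewrite addn0.
rewrite addnS -IH; case: (step (N + d)%N) => // -[h1 h2].
have := hN (N + d)%N (leq_addr _ _); have := hN (N + d).+1 (leqW (leq_addr _ _)) => /=.
rewrite !ltr_norml => /andP[? ?] /andP[? ?]; lra.
Qed.

Lemma rejected_stepsize_lipschitz (alpha L : R) : 0 < alpha -> 0 <= L ->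
  exists2 c : R, 0 < c & forall gam x z, 0 < gam ->
    taylor_rest f x z <= L * enorm (z - x) ^+ 2 ->
    ~ sufficient_decrease f alpha gam x z -> c <= gam.
Proof.
move=> alpha0 L0; exists (alpha / (2 * (L + 1))).
  by rewrite divr_gt0// mulr_gt0// ltr_wpDl.
move=> gam x z gam0 hL nSD; rewrite leNgt; apply/negP => gam_small; apply: nSD.
rewrite /sufficient_decrease -lerBlDl opprD addrA; apply: le_trans hL _.
rewrite ler_wpM2r ?sqr_ge0// ler_pdivlMr; last by rewrite mulr_gt0.
by move: gam_small; rewrite ltr_pdivlMr ?mulr_gt0// ?ltr_wpDl// => ?; nra.
Qed.

Hypotheses (f_diff : forall x, differentiable f x)
  (f_lip : locally_lipschitz_grad f) (g_proper : proper_function g).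

Lemma compact_bound (V : normedModType R) (h : 'rV[R]_n -> V) (M : R) :
  (forall x, h y @[y --> x] --> h x) ->
  exists2 B : R, 0 <= B & forall x, `|x| <= M -> `|h x| <= B.
Proof.
move=> hc.
have [B [_ hB]] : bounded_set (h @` [set x | `|x| <= M]).
  apply: compact_bounded; apply: continuous_compact; last exact: compact_norm_le.
  exact: continuous_subspaceT.
exists (`|B| + 1); first by rewrite addr_ge0.
move=> x xM; apply: hB; last by exists x.
by rewrite (le_lt_trans (ler_norm B))// ltrDl.
Qed.

Lemma cvg_differentiable x : f y @[y --> x] --> f x.
Proof. exact: differentiable_continuous. Qed.

(** Prox-boundedness gives g a quadratic minorant, so comparing the values at z
    and x yields |z - x|^2 / (2 gam) <= C2 + (1 / gam' + 1) |z - x|^2 with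
    constants uniform over the ball of radius M.  For gam small this puts z within
    the radius e of [taylor_rest_compact], where the acceptance test holds as soon
    as e^-1 <= alpha / (2 gam). *)
Lemma rejected_stepsize_bounded (alpha M C : R) (gammag : \bar R) :
  0 < alpha -> prox_bounded gammag g ->
  exists2 c : R, 0 < c & forall gam x z, 0 < gam -> `|x| <= M ->
    (cost f g x <= C%:E)%E -> suboptimal f g gam x x z ->
    ~ sufficient_decrease f alpha gam x z -> c <= gam.
Proof.
move=> alpha0 [gammag0 gammagE].
have [gN _] := g_proper.
have [gam' gam'0 [c0 hc0]] : exists2 gam' : R, 0 < gam' &
    bounded_below (fun x => g x + (1 / (2 * gam') * enorm x ^+ 2)%:E)%E.
  move: gammag0; rewrite gammagE => /ereal_sup_gt[_ [r [r0 hr] <-] _].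
  by exists r.
have [e e0 he] := taylor_rest_compact f_diff f_lip (@compact_norm_le R n M).
have [G0 G00 hG0] := compact_bound (h := grad f) M (cvg_grad f_lip).
have [B B0 hB] := compact_bound (h := f) M cvg_differentiable.
pose G := n%:R * G0; have G_ge0 : 0 <= G by rewrite mulr_ge0.
pose X := n%:R * `|M|; have X_ge0 : 0 <= X by rewrite mulr_ge0.
(* the terms bound, in this order, g x - c0, the minorant at z, and the linear
   term; 1 is added for positivity *)
pose C2 := `|C + B - c0| + X ^+ 2 / gam' + G ^+ 2 + 1.
have C2_gt0 : 0 < C2.
  by rewrite ltr_wpDl// !addr_ge0// ?sqr_ge0// divr_ge0 ?sqr_ge0// ltW.
pose A := 1 / gam' + 1 + C2 / e ^+ 2 + e^-1 / alpha.
have A_gt0 : 0 < A.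
  rewrite !addr_gt0// ?divr_gt0 ?exprn_gt0 ?invr_gt0//.
(* A is such that 1 / (2 gam) > A leaves C2 / e^2 in front of |z - x|^2 after the
   minorant is absorbed, and gives e^-1 <= alpha / (2 gam) *)
exists (1 / (2 * A)); first by rewrite divr_gt0// mulr_gt0.
move=> gam x z gam_gt0 xM cx [sz1 sz2] nSD; rewrite leNgt; apply/negP => gam_small; apply: nSD.
have gamA : A < 1 / (2 * gam).
  rewrite ltr_pdivlMr ?mulr_gt0//; move: gam_small.
  by rewrite ltr_pdivlMr ?mulr_gt0// (_ : A * (2 * gam) = gam * (2 * A))//; ring.
move: sz1 sz2 cx; rewrite !subproblemE model_id /cost.
have := hc0 z; have := gN z; have := gN x.
case: (g z) => [b| |]//; case: (g x) => [a| |]// _ _.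
rewrite -!EFinD !lee_fin => hb _; rewrite /model => sz cx.
set D := enorm (z - x); set t := dotv (grad f x) (z - x) in sz.
have D0 : 0 <= D by exact: enorm_ge0.
have hX : enorm x ^+ 2 <= X ^+ 2.
  rewrite ler_sqr ?nnegrE ?enorm_ge0// (le_trans (enorm_le_normr _))//.
  by rewrite ler_wpM2l// (le_trans xM)// ler_norm.
have hG : enorm (grad f x) <= G.
  by rewrite (le_trans (enorm_le_normr _))// ler_wpM2l// hG0.
have ht : - (G ^+ 2 + D ^+ 2) <= t.
  have := normr_dotv_le (grad f x) (z - x).
  rewrite -/D -/t ler_norml => /andP[h _].
  have : enorm (grad f x) * D <= G * D by rewrite ler_wpM2r.
  have := sqr_ge0 (G - D); have := sqr_ge0 (G + D); rewrite !expr2; lra.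
have hz : enorm z ^+ 2 <= 2 * X ^+ 2 + 2 * D ^+ 2.
  rewrite -(subrK x z) addrC sqr_enormD -/D.
  have := dotv_le_enorm x (z - x); rewrite -/D.
  have := sqr_ge0 (enorm x - D); rewrite expr2 -!expr2; lra.
have fB : - B <= f x by have := hB x xM; rewrite ler_norml => /andP[].
have key : A * D ^+ 2 <= C2 + (1 / gam' + 1) * D ^+ 2.
  have : A * D ^+ 2 <= 1 / (2 * gam) * D ^+ 2 by rewrite ler_wpM2r ?sqr_ge0// ltW.
  have : 1 / (2 * gam') * enorm z ^+ 2 <= 1 / (2 * gam') * (2 * X ^+ 2 + 2 * D ^+ 2).
    by rewrite ler_wpM2l// divr_ge0// mulr_ge0// ltW.
  rewrite (_ : 1 / (2 * gam') * (2 * X ^+ 2 + 2 * D ^+ 2) =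
    X ^+ 2 / gam' + 1 / gam' * D ^+ 2); last by field; lra.
  rewrite /C2; have := ler_norm (C + B - c0); rewrite -/D in sz; lra.
have De : D <= e.
  have e2 : 0 < e ^+ 2 by rewrite exprn_gt0.
  rewrite -ler_sqr ?nnegrE ?(ltW e0)// -(ler_pM2l C2_gt0).
  have : e^-1 / alpha * D ^+ 2 >= 0.
    by rewrite mulr_ge0 ?sqr_ge0// ?divr_ge0 ?invr_ge0 ?ltW.
  move=> ?; have h : C2 / e ^+ 2 * D ^+ 2 <= C2 by move: key; rewrite /A; lra.
  have -> : C2 * D ^+ 2 = C2 / e ^+ 2 * D ^+ 2 * e ^+ 2 by field; rewrite gt_eqF.
  by rewrite ler_wpM2r// ltW.
rewrite /sufficient_decrease -lerBlDl opprD addrA -/(taylor_rest f x z).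
rewrite (le_trans (he _ _ xM De))// -/D ler_wpM2r ?sqr_ge0//.
have : e^-1 / alpha <= 1 / (2 * gam).
  have : 0 <= C2 / e ^+ 2 by rewrite divr_ge0 ?sqr_ge0// ltW.
  have : 0 < 1 / gam' by rewrite divr_gt0.
  by move: gamA; rewrite /A; lra.
by rewrite ler_pdivrMr// mulrC mulrA mulr1.
Qed.

End Backtracking.

(** * Descent, summability and stepsizes along a run *)

Section Run.
Context {R : realType} {n : nat}.
Variables (f : 'rV[R]_n -> R) (g : 'rV[R]_n -> \bar R).
Variables (gammag : \bar R) (x0 : 'rV[R]_n) (gam0 alpha : R).
Variables (xs xbars : nat -> 'rV[R]_n) (gams : nat -> R).
Hypotheses (f_diff : forall x, differentiable f x)
  (f_lip : locally_lipschitz_grad f) (g_proper : proper_function g)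
  (g_pb : prox_bounded gammag g)
  (cost_lb : (-oo < ereal_inf (range (cost f g)))%E)
  (gam0_gt0 : 0 < gam0) (alpha_gt0 : 0 < alpha) (alpha_lt1 : alpha < 1)
  (run : iapg_run f g alpha x0 gam0 xs xbars gams).

Definition gap k : R := enorm (xbars k - xs k).
Definition scaled_sq_gap k : R := 1 / gams k * gap k ^+ 2.
(** The accepted points lie in the domain of g ([g_xbarsE]), so the cost at xbar^k
    and Phi_k can be handled as the real numbers [cost_bar] and
    [subproblem_value]. *)
Definition g_bar k : R := fine (g (xbars k)).
Definition cost_bar k : R := f (xbars k) + g_bar k.
Definition subproblem_value k : R := model f (gams k) (xs k) (xbars k) + g_bar k.

Lemma xs_succ k : xs k.+1 = xbars k.
Proof. by rewrite (run_start run). Qed.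

Lemma run_backtracking k :
  backtracking f g alpha (xs k) (xs k) (previous gam0 gams k) (gams k) (xbars k).
Proof. by have := run_loop run k; rewrite -(run_start run). Qed.

Lemma previous_gams_gt0 k : 0 < previous gam0 gams k.
Proof.
elim: k => [//|k IH] /=.
by have [] := backtracking_last_rejected IH (run_backtracking k).
Qed.

Lemma gams_gt0 k : 0 < gams k.
Proof. exact: (previous_gams_gt0 k.+1). Qed.

Lemma gams_step k : gams k.+1 = gams k \/ exists z, [/\ 2 * gams k.+1 <= gams k,
    suboptimal f g (2 * gams k.+1) (xs k.+1) (xs k.+1) z &
    ~ sufficient_decrease f alpha (2 * gams k.+1) (xs k.+1) z].
Proof.
by have [] := backtracking_last_rejected (gams_gt0 k) (run_backtracking k.+1).
Qed.

Lemma gams_nonincreasing : nonincreasing_seq gams.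
Proof.
apply/nonincreasing_seqP => k; have := gams_gt0 k.+1.
by case: (gams_step k) => [->//|[z [? _ _]] ?]; lra.
Qed.

Lemma g_xbarsE k : g (xbars k) = (g_bar k)%:E.
Proof.
have [[+ _] _] := backtracking_accepted (run_backtracking k).
rewrite /g_bar subproblemE; have := g_proper.1 (xbars k).
by case: (g (xbars k)).
Qed.

Lemma cost_xbarsE k : cost f g (xbars k) = (cost_bar k)%:E.
Proof. by rewrite /cost g_xbarsE. Qed.

Lemma subproblem_valueE k : subproblem f g (gams k) (xs k) (xbars k) = (subproblem_value k)%:E.
Proof. by rewrite subproblemE g_xbarsE. Qed.

(** The acceptance test of the line search, added to g (xbar^k). *)
Lemma cost_bar_le k :
  cost_bar k + (1 - alpha) / 2 * scaled_sq_gap k <= subproblem_value k.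
Proof.
have [_] := backtracking_accepted (run_backtracking k).
rewrite /sufficient_decrease /cost_bar /subproblem_value /model -/(gap k) => h.
have -> : (1 - alpha) / 2 * scaled_sq_gap k =
  1 / (2 * gams k) * gap k ^+ 2 - alpha / (2 * gams k) * gap k ^+ 2.
  by rewrite /scaled_sq_gap; field; rewrite gt_eqF ?gams_gt0.
lra.
Qed.

(** The previous point xbar^k = x^{k+1} competes in subproblem k + 1, where the
    model is exact at its centre. *)
Lemma subproblem_value_next k : subproblem_value k.+1 <= cost_bar k.
Proof.
have [[_ +] _] := backtracking_accepted (run_backtracking k.+1).
rewrite !subproblemE model_id g_xbarsE /subproblem_value /cost_bar xs_succ.
by rewrite g_xbarsE -!EFinD lee_fin.
Qed.

Lemma scaled_sq_gap_ge0 k : 0 <= scaled_sq_gap k.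
Proof. by rewrite mulr_ge0 ?sqr_ge0// divr_ge0// ltW// gams_gt0. Qed.

Lemma cost_bar_le_value k : cost_bar k <= subproblem_value k.
Proof.
apply: le_trans (cost_bar_le k); rewrite lerDl.
by rewrite mulr_ge0 ?scaled_sq_gap_ge0// divr_ge0// subr_ge0 ltW.
Qed.

Lemma scaled_sq_gap_le k :
  scaled_sq_gap k <= 2 / (1 - alpha) * (subproblem_value k - subproblem_value k.+1).
Proof.
have a1 : 0 < 1 - alpha by rewrite subr_gt0.
rewrite mulrAC ler_pdivlMr//.
have := cost_bar_le k; have := subproblem_value_next k; nra.
Qed.

Lemma cost_inf : exists2 m, ereal_inf (range (cost f g)) = m%:E & forall k, m <= cost_bar k.
Proof.
have h k : (ereal_inf (range (cost f g)) <= (cost_bar k)%:E)%E.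
  by rewrite -cost_xbarsE; apply: ereal_inf_lbound; exists (xbars k).
move: cost_lb h; case: ereal_inf => [m| |]// _ h; last by have := h 0%N.
by exists m => // k; rewrite -lee_fin.
Qed.

Lemma value_nonincreasing : nonincreasing_seq subproblem_value.
Proof.
apply/nonincreasing_seqP => k.
exact: le_trans (subproblem_value_next k) (cost_bar_le_value k).
Qed.

Definition phistar : R := limn subproblem_value.

Lemma value_lb : exists2 m, ereal_inf (range (cost f g)) = m%:E &
  forall k, m <= subproblem_value k.
Proof.
have [m mE hm] := cost_inf; exists m => // k.
exact: le_trans (hm k) (cost_bar_le_value k).
Qed.

Lemma value_cvg : subproblem_value @ \oo --> phistar.
Proof.
have [m _ hm] := value_lb.
by apply: nonincreasing_is_cvgn value_nonincreasing _; exists m => _ [k _ <-].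
Qed.

Lemma phistar_le k : phistar <= subproblem_value k.
Proof. by apply: nonincreasing_cvgn_ge value_nonincreasing _ _; apply: value_cvg. Qed.

Lemma le_phistar : (ereal_inf (range (cost f g)) <= phistar%:E)%E.
Proof.
have [m -> hm] := value_lb; rewrite lee_fin.
by apply: limr_ge; [apply: value_cvg|exact: nearW].
Qed.

Lemma value_cvgS : subproblem_value k.+1 @[k --> \oo] --> phistar.
Proof. by apply: cvg_subseq value_cvg => j; exact: leqnSn. Qed.

Lemma cost_bar_cvg : cost_bar @ \oo --> phistar.
Proof.
apply: (squeeze_cvgr _ value_cvgS value_cvg); apply: nearW => k.
by rewrite subproblem_value_next cost_bar_le_value.
Qed.

Lemma sum_scaled_sq_gap_bounded : exists C : R, forall N, \sum_(0 <= k < N) scaled_sq_gap k <= C.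
Proof.
have [m _ hm] := value_lb.
exists (2 / (1 - alpha) * (subproblem_value 0 - m)) => N.
have a1 : 0 <= 2 / (1 - alpha) by rewrite divr_ge0// subr_ge0 ltW.
apply: le_trans (ler_sum _ (fun k _ => scaled_sq_gap_le k)) _.
rewrite -mulr_sumr ler_wpM2l//.
under eq_bigr do rewrite -opprB.
by rewrite sumrN telescope_sumr// opprB lerD2l lerN2.
Qed.

(** gap^2 is gams times [scaled_sq_gap], and both factors are controlled: the
    stepsizes by gam0 and the other one by the vanishing decrements of Phi. *)
Lemma gap_cvg0 : gap @ \oo --> (0 : R).
Proof.
have h : (fun k => gam0 * (2 / (1 - alpha) *
   (subproblem_value k - subproblem_value k.+1))) @ \oo --> (0 : R).
  rewrite -(mulr0 gam0) -(mulr0 (2 / (1 - alpha))) -(subrr phistar).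
  by do 2 apply: cvgMr; apply: cvgB; [exact: value_cvg|exact: value_cvgS].
have sq : (fun k => gap k ^+ 2) @ \oo --> (0 : R).
  apply: (squeeze_cvgr _ (cvg_cst 0) h); apply: nearW => k.
  rewrite sqr_ge0 /=.
  have -> : gap k ^+ 2 = gams k * scaled_sq_gap k.
    by rewrite /scaled_sq_gap; field; rewrite gt_eqF ?gams_gt0.
  apply: ler_pM; rewrite ?scaled_sq_gap_ge0 ?scaled_sq_gap_le ?(ltW (gams_gt0 k))//.
  apply: le_trans (gams_nonincreasing (leq0n k)) _.
  have [_ [->//|[z [h0 _ _]]]] := backtracking_last_rejected gam0_gt0 (run_backtracking 0).
  have := gams_gt0 0%N; move: h0 => /=; lra.
rewrite -sqrtr0.
have -> : gap = (fun k => Num.sqrt (gap k ^+ 2)).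
  by apply/funext => k; rewrite sqrtr_sqr ger0_norm ?enorm_ge0.
apply: (@continuous_cvg _ _ _ _ _ (fun k => gap k ^+ 2) Num.sqrt _ _ sq).
exact: sqrt_continuous.
Qed.

Lemma step_cvg0 : (fun k => xs k.+1 - xs k) @ \oo --> (0 : 'rV[R]_n).
Proof.
apply: enorm_cvg0.
rewrite (_ : (fun k => _) = gap); first exact: gap_cvg0.
by apply/funext => k; rewrite xs_succ.
Qed.

Lemma bounded_gams_constant (M : R) : (forall k, `|xs k| <= M) ->
  exists kappa, forall k, (kappa <= k)%N -> gams k = gams kappa.
Proof.
move=> xsM.
have [c c0 hc] := rejected_stepsize_bounded f_diff f_lip g_proper M
  (subproblem_value 0) alpha_gt0 g_pb.
apply: (stepsizes_eventually_constant c0 gams_gt0) => k.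
case: (gams_step k) => [->|[z [h1 h2 h3]]]; [by left|right; split=> //].
apply: hc h2 h3 => //; first by rewrite mulr_gt0// gams_gt0.
rewrite xs_succ cost_xbarsE lee_fin (le_trans (cost_bar_le_value k))//.
exact: value_nonincreasing.
Qed.

Lemma lipschitz_gams_constant : lipschitz_grad_on f setT ->
  exists kappa, forall k, (kappa <= k)%N -> gams k = gams kappa.
Proof.
move=> /(taylor_rest_lipschitz f_diff)[L L0 hL].
have [c c0 hc] := rejected_stepsize_lipschitz f alpha_gt0 L0.
apply: (stepsizes_eventually_constant c0 gams_gt0) => k.
case: (gams_step k) => [->|[z [h1 h2 h3]]]; [by left|right; split=> //].
by apply: hc h3 => //; rewrite mulr_gt0// gams_gt0.
Qed.

(** By 2 gap <= gams + gap^2 / gams, a bound on the sums of stepsizes bounds the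
    length of the trajectory, hence the iterates; the stepsizes are then
    eventually equal to a positive constant, whose multiples are unbounded. *)
Lemma sum_gams_unbounded : ~ exists C : R, forall N, \sum_(0 <= k < N) gams k <= C.
Proof.
move=> [C hC]; have [C' hC'] := sum_scaled_sq_gap_bounded.
have [|kappa hk] := @bounded_gams_constant (`|xs 0| + (C + C') / 2).
  move=> N; apply: (@le_trans _ _ (`|xs 0| + \sum_(0 <= k < N) gap k)).
    elim: N => [|N IH]; first by rewrite big_geq// addr0.
    rewrite big_nat_recr//= addrA -(subrK (xs N) (xs N.+1)) addrC.
    rewrite (le_trans (ler_normD _ _))// lerD// xs_succ; exact: normr_le_enorm.
  rewrite lerD2l.
  apply: (@le_trans _ _ (\sum_(0 <= k < N) (gams k + scaled_sq_gap k) / 2)).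
    apply: ler_sum => k _; rewrite ler_pdivlMr//.
    have := gams_gt0 k => g0.
    have -> : gams k + scaled_sq_gap k = (gams k - gap k) ^+ 2 / gams k + gap k * 2.
      by rewrite /scaled_sq_gap; field; rewrite gt_eqF.
    by rewrite lerDr divr_ge0 ?sqr_ge0// ltW.
  rewrite -mulr_suml big_split ler_wpM2r//; exact: lerD.
have gk := gams_gt0 kappa.
have C0 : 0 <= C by have := hC 0%N; rewrite big_geq.
have /archi_boundP : 0 <= C / gams kappa by rewrite divr_ge0// ltW.
set N := Num.bound _; rewrite ltr_pdivrMr// ltNge => /negP; apply.
apply: le_trans (hC (kappa + N)%N).
elim: (N) => [|m IH]; first by rewrite mul0r; apply: sumr_ge0 => k _; exact: ltW (gams_gt0 k).
by rewrite addnS big_nat_recr//= -natr1 mulrDl mul1r lerD// hk// leq_addr.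
Qed.

(** If gap / gams >= e from some index on, then gams <= e^-2 gap^2 / gams there,
    and the stepsizes would be summable. *)
Lemma gap_over_gam_frequently_small (e : R) N : 0 < e ->
  exists2 k, (N <= k)%N & 1 / gams k * gap k < e.
Proof.
move=> e0; apply: contrapT => small; apply: sum_gams_unbounded.
have {}small k : (N <= k)%N -> e <= 1 / gams k * gap k.
  by move=> Nk; rewrite leNgt; apply/negP => ?; apply: small; exists k.
have [C hC] := sum_scaled_sq_gap_bounded.
exists (\sum_(0 <= k < N) gams k + C / e ^+ 2) => M.
apply: (@le_trans _ _ (\sum_(0 <= k < N + M) gams k)).
  have : nondecreasing_seq (fun m => \sum_(0 <= k < m) gams k).
    by apply: nondecreasing_series => k _ _; exact: ltW (gams_gt0 k).
  by apply; exact: leq_addl.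
apply: (@le_trans _ _ (\sum_(0 <= k < N) gams k +
    (\sum_(0 <= k < N + M) scaled_sq_gap k) / e ^+ 2));
    last first.
  by rewrite lerD2l ler_wpM2r// invr_ge0 sqr_ge0.
elim: M => [|M IH].
  rewrite addn0 lerDl divr_ge0 ?sqr_ge0//.
  by apply: sumr_ge0 => k _; exact: scaled_sq_gap_ge0.
rewrite addnS !(big_nat_recr (N + M)%N)//= mulrDl addrA lerD//.
rewrite ler_pdivlMr ?exprn_gt0//.
have -> : scaled_sq_gap (N + M) = gams (N + M)%N * (1 / gams (N + M)%N * gap (N + M)%N) ^+ 2.
  by rewrite /scaled_sq_gap; field; rewrite gt_eqF ?gams_gt0.
rewrite ler_pM2l ?gams_gt0// ler_sqr ?nnegrE ?(ltW e0)//.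
  by rewrite small ?leq_addr.
by rewrite (le_trans (ltW e0))// small ?leq_addr.
Qed.

End Run.

Lemma limn_einf_eq0 {R : realType} (u : nat -> R) : (forall k, 0 <= u k) ->
  (forall e N, 0 < e -> exists2 k, (N <= k)%N & u k < e) ->
  limn_einf (fun k => (u k)%:E) = 0%E.
Proof.
move=> u0 small; rewrite limn_einf_lim.
rewrite (_ : einfs _ = fun=> 0%E); first exact: lim_cst.
apply/funext => N; apply/eqP; rewrite eq_le; apply/andP; split.
  apply/lee_addgt0Pr => e e0; rewrite add0e.
  have [k Nk uk] := small e N e0.
  by apply: ge_ereal_inf; exists (u k)%:E; [exists k|rewrite lee_fin ltW].
by apply: le_ereal_inf_tmp => _ [k _ <-]; rewrite lee_fin.
Qed.

(** * Stationarity of limit points *)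

Lemma cvg_at {R : realType} {n : nat} (V : topologicalType) (h : 'rV[R]_n -> V)
    (u : nat -> 'rV[R]_n) x :
  u @ \oo --> x -> h y @[y --> x] --> h x -> h (u j) @[j --> \oo] --> h x.
Proof. exact: cvg_comp. Qed.

Lemma lsc_cvg_le {R : realType} {n : nat} (g : 'rV[R]_n -> \bar R)
    (u : nat -> 'rV[R]_n) x (a : nat -> R) l : lower_semicontinuous g ->
  u @ \oo --> x -> a @ \oo --> l -> (forall k, (g (u k) <= (a k)%:E)%E) ->
  (g x <= l%:E)%E.
Proof.
move=> lsc ux al ga; rewrite leNgt; apply/negP => lg.
have [b lb bg] : exists2 b, l < b & (b%:E < g x)%E.
  move: lg; case: (g x) => [r| |]//; last by exists (l + 1); rewrite ?ltrDl ?ltry.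
  by rewrite lte_fin => lr; exists ((l + r) / 2); rewrite ?lte_fin; lra.
have [V Vx hV] := lsc x b bg.
have uV : \forall k \near \oo, V (u k) by exact: ux.
have ab : \forall k \near \oo, a k < b by exact: (cvgr_lt l).
have [k [Vk abk]] := filter_ex (filterI uV ab).
have := lt_le_trans (hV _ Vk) (ga k).
by rewrite lte_fin ltNge (ltW abk).
Qed.

Lemma has_gradient_model {R : realType} {n : nat} (f : 'rV[R]_n -> R) (gam : R) x z :
  0 < gam -> has_gradient (model f gam x) z (grad f x + gam^-1 *: (z - x)).
Proof.
move=> gam0.
apply: (@quadratic_has_gradient _ _ _ _ _ (1 / (2 * gam)) 1) => //.
  by rewrite divr_ge0// mulr_ge0// ltW.
move=> y _.
have E : y - x = (z - x) + (y - z) by rewrite [RHS]addrC subrKA.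
rewrite /model E sqr_enormD dotvDr (dotvDl (grad f x)) dotvZl.
rewrite (_ : _ - _ = 1 / (2 * gam) * enorm (y - z) ^+ 2); last by field; rewrite gt_eqF.
by rewrite ger0_norm// mulr_ge0 ?sqr_ge0// divr_ge0// mulr_ge0// ltW.
Qed.

(** The sum rule with the summand - model, which cancels the smooth part of the
    subproblem. *)
Lemma model_subdiff {R : realType} {n : nat} (f : 'rV[R]_n -> R) g (gam : R) x z v :
  0 < gam -> never_ninfty g -> limiting_subdiff (subproblem f g gam x) z v ->
  limiting_subdiff g z (v - (grad f x + gam^-1 *: (z - x))).
Proof.
move=> gam0 gN; rewrite subproblemE => hv.
have Eg : g = (fun y => (- model f gam x y)%:E + ((model f gam x y)%:E + g y))%E.
  by apply/funext => y; rewrite addeA -EFinD addNr add0e.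
rewrite {1}Eg addrC.
apply: (@limiting_subdiffD _ _ (fun y => - model f gam x y)
   (fun y => - (grad f x + gam^-1 *: (y - x)))) hv.
- exact: never_ninftyD.
- by move=> y; apply: has_gradientN; exact: has_gradient_model.
- apply: (@cvgN _ _ _ (nbhs z)); apply: (@cvgD _ _ _ (nbhs z)); first exact: cvg_cst.
  apply: (@cvgZr _ _ _ (nbhs z)); apply: (@cvgB _ _ _ (nbhs z)); [exact: cvg_id|exact: cvg_cst].
Qed.

(** Completing the square: the model differs from the proximal quadratic term at
    the gradient step by a constant. *)
Lemma prox_minimizes_subproblem {R : realType} {n : nat} (f : 'rV[R]_n -> R) g (gam : R) x xbar z :
  0 < gam -> prox gam g (x - gam *: grad f x) xbar ->
  (subproblem f g gam x xbar <= subproblem f g gam x z)%E.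
Proof.
move=> gam0 /(_ z); rewrite !subproblemE.
have modelE w : model f gam x w = (f x - gam / 2 * enorm (grad f x) ^+ 2) +
    1 / (2 * gam) * enorm (w - (x - gam *: grad f x)) ^+ 2.
  rewrite /model opprB addrCA [gam *: _ + _]addrC (sqr_enormD (w - x)) enormZ dotvZr.
  by rewrite gtr0_norm// (dotvC (w - x)); field; rewrite gt_eqF.
rewrite !modelE !EFinD -!addeA ![(_ + g _)%E]addeC => h.
by rewrite !leeD2lE.
Qed.

(** The stepsizes are assumed constant from the index kappa on, as they are when
    the iterates are bounded. *)
Section LimitPointsOfRun.
Context {R : realType} {n : nat}.
Variables (f : 'rV[R]_n -> R) (g : 'rV[R]_n -> \bar R).
Variables (x0 : 'rV[R]_n) (gam0 alpha : R).
Variables (xs xbars : nat -> 'rV[R]_n) (gams : nat -> R).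
Hypotheses (f_diff : forall x, differentiable f x)
  (f_lip : locally_lipschitz_grad f) (g_proper : proper_function g)
  (g_lsc : lower_semicontinuous g)
  (cost_lb : (-oo < ereal_inf (range (cost f g)))%E)
  (gam0_gt0 : 0 < gam0) (alpha_lt1 : alpha < 1)
  (run : iapg_run f g alpha x0 gam0 xs xbars gams).
Implicit Types (x z : 'rV[R]_n) (s : nat -> nat).
Variable kappa : nat.
Hypothesis gams_const : forall k, (kappa <= k)%N -> gams k = gams kappa.

Let phis := phistar f g xs xbars gams.
Let gam := gams kappa.

Let gam_gt0 : 0 < gam.
Proof. exact: gams_gt0 run kappa. Qed.

Lemma xbars_sub_xs_cvg0 : (fun k => xbars k - xs k) @ \oo --> (0 : 'rV[R]_n).
Proof. by apply: enorm_cvg0; exact: gap_cvg0 run. Qed.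

Lemma xs_subseq_cvg s x : (forall j, (j <= s j)%N) ->
  xbars (s j) @[j --> \oo] --> x -> xs (s j) @[j --> \oo] --> x.
Proof.
move=> js bx; rewrite -[x]subr0.
have -> : (fun j => xs (s j)) = (fun j => xbars (s j) - (xbars (s j) - xs (s j))).
  by apply/funext => j; rewrite subKr.
by apply: cvgB => //; exact: (cvg_subseq js xbars_sub_xs_cvg0).
Qed.

(** Along the subsequence g (xbar^k) = phi (xbar^k) - f (xbar^k), whose first
    term tends to phistar; lower semicontinuity does the rest. *)
Lemma limit_point_cost_le x : limit_points xbars x -> (g x <= (phis - f x)%:E)%E.
Proof.
move=> /limit_pointsP[s js bx].
apply: (@lsc_cvg_le _ _ g _ x (fun j => cost_bar f g xbars (s j) - f (xbars (s j)))
  _ g_lsc bx).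
  apply: cvgB; first exact: (cvg_subseq js (cost_bar_cvg g_proper cost_lb gam0_gt0 alpha_lt1 run)).
  exact: (cvg_at bx (cvg_differentiable f_diff (x := x))).
by move=> j; rewrite (g_xbarsE g_proper run) lee_fin /cost_bar addrC addKr.
Qed.

(** The infimum in the distance need not be attained at step k, so v k is only
    chosen with norm at most delta + 1 / (k + 1); the excess vanishes in the
    limit. *)
Lemma limit_point_delta_stationary delta x : 0 < delta ->
  (forall k, delta_stationary delta (subproblem f g (gams k) (xs k)) (xbars k)) ->
  closed_relative_to (edom g `*` setT) (subdiff_graph g) ->
  limit_points xbars x -> delta_stationary delta (cost f g) x.
Proof.
move=> delta0 stat [C closedC graphE] wx.
have gN := g_proper.1.
have gx : edom g x by rewrite /edom /=; apply: le_lt_trans (limit_point_cost_le wx) (ltry _).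
have /choice[v hv] k : exists v, limiting_subdiff (subproblem f g (gams k) (xs k)) (xbars k) v
    /\ enorm v <= delta + k.+1%:R^-1.
  have : (Defs.edist 0 (limiting_subdiff (subproblem f g (gams k) (xs k)) (xbars k)) <
     (delta + k.+1%:R^-1)%:E)%E.
    by apply: le_lt_trans (stat k) _; rewrite lte_fin ltrDl.
  move=> /ereal_inf_lt[_ [v vS <-]]; rewrite lte_fin sub0r enormN => vd.
  by exists v; split => //; exact: ltW.
have [s js bx] := (limit_pointsP _ _).1 wx.
have [vlim /limit_pointsP[t jt vt]] : exists vlim, limit_points (v \o s) vlim.
  (* the subgradients are bounded: refine the subsequence so that they converge *)
  apply: (@bounded_limit_point _ _ _ (delta + 1)) => k.
  rewrite (le_trans (normr_le_enorm _))// (le_trans (hv (s k)).2)// lerD2l.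
  by rewrite invf_le1 ?ler1n.
pose r j := s (t j).
have jr j : (j <= r j)%N by apply: leq_trans (jt j) (js _).
have {}bx : xbars (r j) @[j --> \oo] --> x by exact: (cvg_subseq jt bx).
have xx := xs_subseq_cvg jr bx.
have gradx : grad f (xs (r j)) @[j --> \oo] --> grad f x.
  exact: (cvg_at xx (cvg_grad f_lip (x := x))).
have v_le : enorm vlim <= delta.
  rewrite -[delta]addr0.
  apply: (@ler_cvg_to nat \oo _ _ (fun j => enorm (v (r j)))
    (fun j => delta + (r j).+1%:R^-1)).
  - exact: cvg_enorm vt.
  - by apply: cvgD; [exact: cvg_cst|exact: (cvg_subseq jr (@cvg_harmonic R))].
  - by apply: nearW => j; exact: (hv (r j)).2.
pose w j := v (r j) - (grad f (xs (r j)) + gam^-1 *: (xbars (r j) - xs (r j))).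
have w_cvg : w @ \oo --> vlim - grad f x.
  rewrite -[grad f x]addr0; apply: cvgB => //; apply: cvgD => //.
  rewrite -(scaler0 _ gam^-1); apply: cvgZr; exact: (cvg_subseq jr xbars_sub_xs_cvg0).
have wg : \forall j \near \oo, C (xbars (r j), w j).
  near=> j; suff : (C `&` (edom g `*` setT)) (xbars (r j), w j) by case.
  rewrite -graphE /subdiff_graph /= /w.
  have -> : gam = gams (r j).
    by rewrite gams_const//; apply: leq_trans (jr j); near: j; exact: nbhs_infty_ge.
  by apply: model_subdiff => //; [exact: gams_gt0 run _|exact: (hv (r j)).1].
have Cx : C (x, vlim - grad f x).
  apply: (@closed_cvg nat _ \oo _ (fun j => (xbars (r j), w j)) C closedC wg).
  exact: (cvg_pair bx w_cvg).
have hg : limiting_subdiff g x (vlim - grad f x).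
  have : subdiff_graph g (x, vlim - grad f x) by rewrite graphE; split.
  by [].
have hcost : limiting_subdiff (cost f g) x vlim.
  rewrite -(subrKC (grad f x) vlim).
  apply: (@limiting_subdiffD _ _ f (grad f)) => //; last exact: cvg_grad.
  by move=> y; exact: has_gradient_grad.
apply: ge_ereal_inf; exists (enorm (0 - vlim))%:E; first by exists vlim.
by rewrite lee_fin sub0r enormN.
Unshelve. all: by end_near. Qed.

(** Local optimality of xbar^k compares Phi_k with the value of subproblem k at a
    fixed z; both sides converge along the subsequence, the right one because
    only the model, which is continuous in its centre, varies with k. *)
Lemma limit_point_local_min (rad : \bar R) eps x :
  eventually_locally_optimal f g rad eps xs xbars gams -> limit_points xbars x ->
  exists2 rho : R, 0 < rho & forall z, enorm (z - x) < rho ->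
    (phis%:E <= (model f gam x z)%:E + g z)%E.
Proof.
move=> [rad0 _ eps0 opt] wx.
have [rho rho0 rhor] : exists2 rho : R, 0 < rho & (rho%:E <= rad)%E.
  by move: rad0; case: rad {opt} => [r| |]//; [exists r|exists 1; rewrite ?leey].
exists rho => // z zx.
have [s js bx] := (limit_pointsP _ _).1 wx.
have xx := xs_subseq_cvg js bx.
have := g_proper.1 z; case gz : (g z) => [b| |]// _; last by rewrite addey// leey.
rewrite -EFinD lee_fin.
apply: (@ler_cvg_to nat \oo _ _ (fun j => subproblem_value f g xs xbars gams (s j))
  (fun j => model f gam (xs (s j)) z + b + eps (s j))).
- exact: (cvg_subseq js (value_cvg g_proper cost_lb gam0_gt0 alpha_lt1 run)).
- rewrite -[_ + b]addr0; apply: cvgD; last exact: (cvg_subseq js eps0).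
  apply: cvgD; last exact: cvg_cst.
  have dz : (z - xs (s j)) @[j --> \oo] --> z - x by apply: cvgB => //; exact: cvg_cst.
  apply: cvgD.
    apply: cvgD; first exact: (cvg_at xx (cvg_differentiable f_diff (x := x))).
    apply: cvg_dotv => //.
    exact: (cvg_at xx (cvg_grad f_lip (x := x))).
  by apply: cvgMr; rewrite !expr2; apply: cvgM; exact: cvg_enorm.
- have zb : enorm (z - xbars (s j)) @[j --> \oo] --> enorm (z - x).
    by apply: cvg_enorm; apply: cvgB => //; exact: cvg_cst.
  near=> j; rewrite -lee_fin.
  have -> : gam = gams (s j).
    by rewrite gams_const//; apply: leq_trans (js j); near: j; exact: nbhs_infty_ge.
  rewrite -(subproblem_valueE g_proper run).
  have zj : ((enorm (z - xbars (s j)))%:E <= rad)%E.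
    apply: le_trans rhor; rewrite lee_fin ltW//; near: j; exact: (cvgr_lt _ zb).
  have optj : forall z, ((enorm (z - xbars (s j)))%:E <= rad)%E ->
        (subproblem f g (gams (s j)) (xs (s j)) (xbars (s j)) <=
         subproblem f g (gams (s j)) (xs (s j)) z + (eps (s j))%:E)%E.
    by near: j; exact: (cvg_ge_id js opt).
  by apply: le_trans (optj _ zj) _; rewrite subproblemE gz -!EFinD.
Unshelve. all: by end_near. Qed.

(** Taking z = x in [limit_point_local_min] gives phistar <= phi(x), the converse
    of [limit_point_cost_le].  Near x the model exceeds f by o(|z - x|), so the
    local minimum of the model plus g makes 0 a regular subgradient of phi. *)
Lemma limit_point_stationary (rad : \bar R) eps x :
  eventually_locally_optimal f g rad eps xs xbars gams -> limit_points xbars x ->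
  limiting_subdiff (cost f g) x 0 /\ cost f g x = phis%:E.
Proof.
move=> opt wx; have [rho rho0 lmin] := limit_point_local_min opt wx.
have gx_le := limit_point_cost_le wx.
have gx : edom g x by rewrite /edom /=; apply: le_lt_trans gx_le (ltry _).
have cx : cost f g x = phis%:E.
  move: (lmin x); rewrite subrr enorm0 model_id => /(_ rho0); move: gx_le.
  rewrite /cost; have := g_proper.1 x; case: (g x) => [b| |]// _.
  rewrite -EFinD !lee_fin => h1 h2; congr EFin; lra.
split => //; apply: regular_sub_limiting; apply/regular_subdiffP.
  exact: never_ninftyD g_proper.1.
split; first exact: edomD.
move=> e e0; rewrite cx.
have e20 : 0 < e / 2 by rewrite divr_gt0.
near=> z.
have zrho : enorm (z - x) < rho by near: z; exact: near_enorm_lt.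
have zgam : enorm (z - x) < e * gam.
  by near: z; apply: near_enorm_lt; rewrite mulr_gt0.
have : `|f z - f x - dotv (grad f x) (z - x)| <= e / 2 * enorm (z - x).
  by near: z; exact: (has_gradient_grad x f_diff f_lip e20).
have := lmin z zrho; rewrite /cost.
have := g_proper.1 z; case: (g z) => [b| |]// _; last by move=> *; rewrite addey// leey.
rewrite -!EFinD !lee_fin dotv0l /model ler_norml => h1 /andP[h2 h3].
have : 1 / (2 * gam) * enorm (z - x) ^+ 2 <= e / 2 * enorm (z - x).
  rewrite expr2 mulrA ler_wpM2r ?enorm_ge0// mulrC.
  rewrite ler_pdivlMr//; move: zgam.
  rewrite (_ : enorm (z - x) * (1 / (2 * gam)) * 2 = enorm (z - x) / gam); last first.
    by field; rewrite gt_eqF.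
  by rewrite ler_pdivrMr// => /ltW.
lra.
Unshelve. all: by end_near. Qed.

End LimitPointsOfRun.

(** * The convergence theorem *)

Theorem corollary4p7 (R : realType) (n : nat)
    (f : 'rV[R]_n -> R) (g : 'rV[R]_n -> \bar R)
    (gammag : \bar R) (x0 : 'rV[R]_n) (gam0 alpha : R)
    (xs xbars : nat -> 'rV[R]_n) (gams : nat -> R)
    (f_diff : forall x, differentiable f x)
    (f_lip : locally_lipschitz_grad f)
    (g_proper : proper_function g)
    (g_lsc : lower_semicontinuous g)
    (g_pb : prox_bounded gammag g)
    (cost_lb : (-oo < ereal_inf (range (cost f g)))%E)
    (gam0_gt0 : 0 < gam0) (gam0_lt : (gam0%:E < gammag)%E)
    (alpha_gt0 : 0 < alpha) (alpha_lt1 : alpha < 1)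
    (run : iapg_run f g alpha x0 gam0 xs xbars gams) :
  let Phi := fun k => subproblem f g (gams k) (xs k) (xbars k) in
  let omega := limit_points xbars in
  let gams_eventually_constant :=
    exists kappa, forall k, (kappa <= k)%N -> gams k = gams kappa in
  exists phistar : R,
    (* (i) *)
    [/\ Phi @ \oo --> phistar%:E,
        (forall k, phistar%:E <= Phi k)%E
      & (ereal_inf (range (cost f g)) <= phistar%:E)%E] /\
    (* (ii) *)
    (\sum_(0 <= k <oo) (1 / gams k * enorm (xbars k - xs k) ^+ 2)%:E < +oo)%E /\
    (* (iii) *)
    [/\ enorm (xs k - xbars k) @[k --> \oo] --> (0 : R),
        enorm (xs k.+1 - xs k) @[k --> \oo] --> (0 : R)
      & enorm (xbars k.+1 - xbars k) @[k --> \oo] --> (0 : R)] /\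
    (* connectedness fails in general for unbounded sets of limit points *)
    [/\ closed (limit_points xs),
        bounded_set (limit_points xs) -> connected (limit_points xs)
      & limit_points xs = limit_points xbars] /\
    (* (iv) *)
    (\sum_(0 <= k <oo) (gams k)%:E = +oo)%E /\
    (* (v) *)
    limn_einf (fun k => (1 / gams k * enorm (xs k - xbars k))%:E) = 0%E /\
    (* (vi) *)
    [/\ level_bounded (cost f g) -> bounded_set (range xbars),
        bounded_set (range xbars) <-> bounded_set (range xs),
        bounded_set (range xs) -> gams_eventually_constant
      & lipschitz_grad_on f setT -> gams_eventually_constant] /\
    (* (vii) *)
    (coercive (cost f g) -> bounded_set (range xbars)) /\
    (bounded_set (range xbars) ->
      (* (a) *)
      (forall delta : R, 0 < delta ->
        (forall k, delta_stationary delta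
                     (subproblem f g (gams k) (xs k)) (xbars k)) ->
        closed_relative_to (edom g `*` setT) (subdiff_graph g) ->
        forall x, omega x -> delta_stationary delta (cost f g) x) /\
      (* (b) *)
      ((exists r eps, eventually_locally_optimal f g r eps xs xbars gams) ->
        forall x, omega x ->
          limiting_subdiff (cost f g) x 0 /\ cost f g x = phistar%:E)) /\
    ((forall k, prox (gams k) g (xs k - gams k *: grad f (xs k)) (xbars k)) ->
      eventually_locally_optimal f g +oo%E (fun=> 0) xs xbars gams).
Proof.
move=> Phi omega gams_eventually_constant.
have boundedE (u : nat -> 'rV[R]_n) :
    bounded_set (range u) <-> exists M : R, forall k, `|u k| <= M.
  split=> [[M [_ hM]]|[M hM]].
    by exists (M + 1) => k; apply: hM; [rewrite ltrDl|exists k].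
  by exists M; split; [exact: num_real|move=> r Mr _ [k _ <-]; exact: le_trans (hM k) (ltW Mr)].
have bounded_iff : bounded_set (range xbars) <-> bounded_set (range xs).
  split=> /boundedE[M hM]; apply/boundedE.
    exists (Num.max M `|xs 0|) => -[|k]; first by rewrite le_max lexx orbT.
    by rewrite (xs_succ run) le_max hM.
  by exists M => k; rewrite -(xs_succ run).
have bounded_const : bounded_set (range xs) -> gams_eventually_constant.
  move=> /boundedE[M hM].
  exact: (bounded_gams_constant f_diff f_lip g_proper g_pb gam0_gt0 alpha_gt0
    alpha_lt1 run hM).
have cost_bar_le0 k : cost_bar f g xbars k <= subproblem_value f g xs xbars gams 0.
  apply: le_trans (cost_bar_le_value gam0_gt0 alpha_lt1 run k) _ => //.
  exact: (value_nonincreasing g_proper gam0_gt0 alpha_lt1 run).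
have scaled_sq_gap_sum : (\sum_(0 <= k <oo) (scaled_sq_gap xs xbars gams k)%:E < +oo)%E.
  apply/nneseries_lt_pinftyP; last first.
    exact: (sum_scaled_sq_gap_bounded g_proper cost_lb gam0_gt0 alpha_lt1 run).
  exact: (scaled_sq_gap_ge0 gam0_gt0 run).
exists (phistar f g xs xbars gams).
split.
  have PhiE : Phi = EFin \o subproblem_value f g xs xbars gams.
    by apply/funext => k; rewrite /Phi (subproblem_valueE g_proper run).
  split; last exact: (le_phistar g_proper cost_lb gam0_gt0 alpha_lt1 run).
  - rewrite PhiE; apply: cvg_EFin; first exact: nearW.
    exact: (value_cvg g_proper cost_lb gam0_gt0 alpha_lt1 run).
  - by move=> k; rewrite PhiE lee_fin; exact: (phistar_le g_proper cost_lb gam0_gt0 alpha_lt1 run).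
split; first exact: scaled_sq_gap_sum.
split.
  have gap0 := gap_cvg0 g_proper cost_lb gam0_gt0 alpha_lt1 run.
  split.
  - by under eq_fun do rewrite enormBC.
  - by under eq_fun do rewrite (xs_succ run).
  - have := cvg_subseq leqnSn gap0; rewrite /gap.
    by under eq_fun do rewrite (xs_succ run).
split.
  have diff0 := xbars_sub_xs_cvg0 g_proper cost_lb gam0_gt0 alpha_lt1 run.
  split; first exact: closed_limit_points.
  - by apply: connected_limit_points; exact: (step_cvg0 g_proper cost_lb gam0_gt0 alpha_lt1 run).
  - apply/seteqP; split; apply: sub_limit_points => //.
    rewrite -oppr0; under eq_fun do rewrite -opprB.
    exact: cvgN.
split.
  apply/eqP; rewrite eq_le leey leNgt /=; apply/negP => h.
  apply: (sum_gams_unbounded f_diff f_lip g_proper g_pb cost_lb gam0_gt0 alpha_gt0 alpha_lt1 run).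
  by apply/nneseries_lt_pinftyP => // k; exact: ltW (gams_gt0 gam0_gt0 run k).
split.
  apply: limn_einf_eq0 => [k|e N e0].
    by rewrite mulr_ge0 ?enorm_ge0// divr_ge0// ltW// (gams_gt0 gam0_gt0 run).
  have [k Nk hk] := gap_over_gam_frequently_small f_diff f_lip g_proper g_pb cost_lb
    gam0_gt0 alpha_gt0 alpha_lt1 run N e0.
  by exists k => //; rewrite enormBC.
split.
  split => //.
  - move=> /(_ (subproblem_value f g xs xbars gams 0))[M [Mr hM]].
    exists M; split=> // r Mr' _ [k _ <-]; apply: hM => //=.
    by rewrite (cost_xbarsE g_proper run) lee_fin.
  - exact: (lipschitz_gams_constant f_diff gam0_gt0 alpha_gt0 run).
split.
  move=> /(_ (subproblem_value f g xs xbars gams 0 + 1))[r hr].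
  apply/boundedE; exists r => k; apply: le_trans (normr_le_enorm _) _.
  rewrite leNgt; apply/negP => /hr.
  rewrite (cost_xbarsE g_proper run) lee_fin; have := cost_bar_le0 k; lra.
split.
  move=> /bounded_iff/bounded_const[kappa hkappa]; split.
    move=> delta delta0 stat graph x wx.
    exact: (limit_point_delta_stationary f_diff f_lip g_proper g_lsc cost_lb gam0_gt0
      alpha_lt1 run hkappa delta0 stat graph wx).
  move=> [r [eps opt]] x wx.
  exact: (limit_point_stationary f_diff f_lip g_proper g_lsc cost_lb gam0_gt0
      alpha_lt1 run hkappa opt wx).
move=> hprox; split; [by []|by move=> i j _|exact: cvg_cst|].
apply: nearW => k z _; rewrite adde0.
by apply: prox_minimizes_subproblem => //; exact: (gams_gt0 gam0_gt0 run).
Qed.
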